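(* Let $n\ge 1$ and $0\le t\le 1$. Then the minimal travel time $T_n$ satisfies $$\mathbb{P}(T_n\ge 1-t)=\int_0^{1/2}\!\int_0^{1/2}\sum_{k=1}^{n-1}\binom{n}{k}k\,u^{k-1}(n-k)v^{n-k-1}\,P_{k-1}(t/u)\,P_{n-k-1}(t/v)\,\mathbf{1}_{[1-v-u-u\wedge v\le t]}\,du\,dv$$ $$\qquad\qquad+\;2\cdot\mathbf{1}_{[t>1/2]}\int_{1-t}^{1/2}n\,u^{n-1}P_{n-1}(t/u)\,du ,$$ where $u\wedge v=\min\{u,v\}$ and an empty sum is $0$.
   Context: For each $m\ge1$, let $U_1,\dots,U_m$ be independent random variables uniformly distributed on $[0,1)$, with order statistics $0=U_{0:m}<U_{1:m}<\cdots<U_{m:m}<U_{m+1:m}=1$ and uniform spacings $D_{i,m}=U_{i:m}-U_{i-1:m}$, $1\le i\le m+1$. Define $$P_m(t)=\mathbb{P}\Big(\max_{1\le j\le m+1}\{D_{j,m}-U_{j-1:m}\}\le t\Big),\quad m=1,2,\ldots,\ t\ge0,\qquad P_0(t)=\mathbf{1}_{[t>1]},\ t\ge 0.$$ $T_n$ is the minimal travel time of a picker who starts at point $0$ of a circle of length $1$ (identified with $[0,1)$) and must collect $n$ items located at the independent uniform points $U_1,\dots,U_n$, moving along the circle at unit speed in either direction (not required to return to $0$). It is given by $$T_n=1-\max\Big\{\max_{1\le j\le n}\{D_{j,n}-U_{j-1:n}\},\ \max_{1\le j\le n}\{D_{n+2-j,n}-(1-U_{n+2-j:n})\}\Big\}.$$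 $\mathbf{1}_{[\cdot]}$ denotes an indicator. *)

(* Defs.v *)
From HB Require Import structures.
From mathcomp Require Import all_boot all_order all_algebra.
From mathcomp Require Import all_classical all_reals all_analysis.
Set Implicit Arguments.
Unset Strict Implicit.
Unset Printing Implicit Defensive.
Import Order.TTheory GRing.Theory Num.Theory.
Import numFieldNormedType.Exports.
Local Open Scope classical_set_scope.
Local Open Scope ring_scope.

Definition mutually_independent (d d' : measure_display) (T : measurableType d)
    (T' : measurableType d') (R : realType) (P : probability T R)
    (I : finType) (X : I -> {RV P >-> T'}) : Prop :=
  forall (J : {set I}) (B : I -> set T'),
    (forall i, measurable (B i)) ->
    P [set w | forall i, i \in J -> B i (X i w)] =
      (\prod_(i in J) P (X i @^-1` B i))%E.

(* The equality is required on Borel sets only: the value of a measure on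
   other sets carries no meaning.  [uniform_prob] is stated on [0, 1], which
   gives the same law as [0, 1). *)
Definition uniform01 (d : measure_display) (T : measurableType d)
    (R : realType) (P : probability T R) (X : {RV P >-> R}) : Prop :=
  forall A : set R, measurable A ->
    distribution P X A = uniform_prob (@ltr01 R) A.

(* U_{i:m}, for 0 <= i <= m+1, with U_{0:m} = 0 and U_{m+1:m} = 1. *)
Definition ordstat (R : realType) (m : nat) (x : 'I_m -> R) (i : nat) : R :=
  nth 0 (0 :: rcons (sort <=%R [seq x j | j <- enum 'I_m]) 1) i.

(* D_{i,m}, meaningful for 1 <= i <= m+1. *)
Definition spacing (R : realType) (m : nat) (x : 'I_m -> R) (i : nat) : R :=
  ordstat x i - ordstat x i.-1.

(* max_{1 <= j <= m} F j, for m >= 1.  Starting the iteration from the entry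
   F 1 makes this the exact maximum, with no default value interfering. *)
Definition max_1_to (R : realType) (m : nat) (F : nat -> R) : R :=
  \big[Num.max/F 1%N]_(1 <= j < m.+1) F j.

Definition travel_time (R : realType) (n : nat) (x : 'I_n -> R) : R :=
  1 - Num.max
        (max_1_to n (fun j => spacing x j - ordstat x j.-1))
        (max_1_to n (fun j => spacing x (n.+2 - j)
                              - (1 - ordstat x (n.+2 - j)))).

(* P_m(t); row m of the array U is the sample of size m. *)
Definition Pm (d : measure_display) (T : measurableType d) (R : realType)
    (P : probability T R) (U : forall m : nat, 'I_m -> {RV P >-> R})
    (m : nat) (t : R) : R :=
  if m == 0%N then (1 < t)%R%:R
  else fine (P [set w | max_1_to m.+1
         (fun j => spacing (fun i => U m i w) j
                   - ordstat (fun i => U m i w) j.-1) <= t]).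

(* Main.v *)
Require Import Defs.
From HB Require Import structures.
From mathcomp Require Import all_boot all_order all_algebra all_fingroup.
From mathcomp Require Import all_classical all_reals all_analysis.
From mathcomp Require Import measurable_realfun.
From mathcomp Require Import ring lra.
Set Implicit Arguments.
Unset Strict Implicit.
Unset Printing Implicit Defensive.
Import Order.TTheory GRing.Theory Num.Theory.
Import numFieldNormedType.Exports.
Local Open Scope classical_set_scope.
Local Open Scope ring_scope.

(** Write [q <= 2 p + t] for a step from [p] to [q].  The bound [D_j - U_{j-1}
    <= t] says that the step from [U_{j-1:n}] to [U_{j:n}] is allowed, so
    [T_n >= 1 - t] holds iff both the sorted sample and its mirror image under
    [x |-> 1 - x] are reached from 0 by allowed steps.  A step that starts at or
    after 1/2 is always allowed.  Hence, if [k] points lie in [[0, 1/2)], with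
    maximum [u], and the others lie at distance at most [v] from 1 in [[1/2, 1]],
    the event splits into: the left points form a chain, the mirrored right
    points form a chain, and [1 - v - u - min u v <= t].  Which points lie on the
    left gives the factor ['C(n, k)]; given its maximum [u], the rest of the left
    block is a uniform sample scaled by [u], whence the density
    [k u^(k-1) P_{k-1}(t/u)]. *)

(** * Uniform laws on tuples *)

(** Apart from the final assembly, everything is proved for a family [mu n] of probabilities on
    tuples that is a product on boxes. This determines it, so exchangeability, concatenation,
    reflection and scaling all reduce to computations on boxes. The factor [k u^(k-1)] arises
    without differentiating a distribution function: any of the [k] coordinates may be the strict
    maximum, and fixing one at [u] leaves [k-1] points below [u], an event of mass [u^(k-1)] times a
    probability for the sample divided by [u]. That division turns the tolerance [t] into [t/u] and
    the end point [u] into 1. The two blocks interact only through their maxima, hence the law of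
    the maximum carries an arbitrary weight [h] and is applied twice, once inside the other. The
    term [min u v] comes from two crossing steps, [1 - v <= 2 u + t] for the sample and
    [1 - u <= 2 v + t] for its mirror image. The obstacle is that the pointwise identities fail on
    null sets: ties, points at 1/2, negative coordinates, and [u = t], where [P_0] departs from its
    event. The passage to integrals is therefore made almost everywhere. *)

Lemma ge0_integral_pushforwardT d1 d2 (X : measurableType d1)
    (Y : measurableType d2) (R : realType) (phi : X -> Y)
    (mphi : measurable_fun [set: X] phi) (m : {measure set X -> \bar R})
    (F : Y -> \bar R) :
  measurable_fun [set: Y] F -> (forall y, 0 <= F y)%E ->
  (\int[m]_x F (phi x) = \int[pushforward m phi]_y F y)%E.
Proof. by move=> mF F0; rewrite ge0_integral_pushforward. Qed.

Section boxes.
Context (R : realType).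
Implicit Types n p q : nat.

Definition box n (B : 'I_n -> set R) : set (n.-tuple R) :=
  [set x | forall i, B i (tnth x i)].

Definition boxes n : set (set (n.-tuple R)) :=
  [set A | exists2 B : 'I_n -> set R, (forall i, measurable (B i)) & A = box B].

Lemma boxT n : box (fun _ : 'I_n => setT) = setT.
Proof. by apply/seteqP; split. Qed.

Lemma setI_closed_boxes n : setI_closed (@boxes n).
Proof.
move=> _ _ [B mB ->] [C mC ->]; exists (fun i => B i `&` C i).
  by move=> i; exact: measurableI.
apply/seteqP; split=> x /=.
  by move=> [Bx Cx] i; split.
by move=> BCx; split=> i; have [] := BCx i.
Qed.

Lemma measurable_box n (B : 'I_n -> set R) :
  (forall i, measurable (B i)) -> measurable (box B).
Proof.
move=> mB.
rewrite (_ : box B = \bigcap_(i in [set: 'I_n]) ((@tnth n R ^~ i) @^-1` B i)).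
  apply: fin_bigcap_measurable => // i _.
  by rewrite -[X in measurable X]setTI; exact: measurable_tnth.
by apply/seteqP; split=> [x Bx i _|x Bx i]; exact: Bx.
Qed.

(** A coordinate preimage is a box with one nontrivial side, so the boxes, which are stable under
    intersection, generate the same sigma-algebra as the coordinates. *)
Lemma measurable_boxes n :
  (measurable : set (set (n.-tuple R))) = <<s @boxes n >>.
Proof.
apply/seteqP; split; apply: smallest_sub.
- exact: smallest_sigma_algebra.
- move=> A; rewrite -bigcup_seq/= => -[i _ [B mB <-]].
  apply: sub_sigma_algebra; exists (fun j => if j == i then B else setT).
    by move=> j; case: ifP.
  rewrite setTI; apply/seteqP; split=> x /=.
    by move=> Bx j; case: eqP => [->|].
  by move=> /(_ i); rewrite eqxx.
- exact: sigma_algebra_measurable.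
- by move=> _ [B mB ->]; exact: measurable_box.
Qed.

Lemma tuple_measure_unique n (m1 m2 : {measure set (n.-tuple R) -> \bar R}) :
  (m1 setT < +oo)%E ->
  (forall B : 'I_n -> set R, (forall i, measurable (B i)) ->
    m1 (box B) = m2 (box B)) ->
  forall A, measurable A -> m1 A = m2 A.
Proof.
move=> m1oo m12; apply: (measure_unique (@boxes n) (fun=> setT)) => //.
- exact: measurable_boxes.
- exact: setI_closed_boxes.
- by move=> _; exists (fun=> setT) => //; rewrite boxT.
- by rewrite bigcup_const//; exists 0%N.
- by move=> _ [B mB ->]; exact: m12.
Qed.

End boxes.

(** * Uniform law on [0, 1]: scaling, reflection and null points *)

Section uniform01_prob.
Context (R : realType).
Local Notation unif := (uniform_prob (@ltr01 R)).
Local Notation lambda := (@lebesgue_measure R).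

Lemma uniform01E (A : set R) : measurable A -> unif A = lambda (A `&` `[0, 1]).
Proof.
move=> mA; rewrite /uniform_prob integral_uniform_pdf.
rewrite (@eq_integral _ _ _ _ _ (cst 1%E)); last first.
  move=> x; rewrite inE => -[_ /=]; rewrite in_itv/= => x01.
  by rewrite /uniform_pdf x01 subr0 invr1.
by rewrite integral_cst ?mul1e//; exact: measurableI.
Qed.

Lemma lebesgue_measure_scale (v : R) (A : set R) : 0 < v -> measurable A ->
  lambda [set x | A (x / v)] = (v%:E * lambda A)%E.
Proof.
move=> v0 mA.
pose f := (fun x => x / v) : measurableTypeR R -> measurableTypeR R.
have mf : measurable_fun [set: measurableTypeR R] f.
  exact: (@mulrr_measurable R setT v^-1).
have vV0 : 0 <= v^-1 by rewrite invr_ge0 ltW.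
have H : lambda A = mscale (NngNum vV0) (pushforward lambda f) A.
  move=> ?; apply: lebesgue_measure_unique mA => _ [[a b]] _ <-.
  rewrite /= /mscale /= /pushforward.
  rewrite (_ : f @^-1` _ = `](v * a), (v * b)]%classic); last first.
    by apply/seteqP; split=> x /=; rewrite /f !in_itv/= ltr_pdivlMr//
      ler_pdivrMr// mulrC (mulrC b).
  rewrite !lebesgue_measure_itv/= !lte_fin ltr_pM2l//.
  case: ifPn => _; last by rewrite mule0.
  by rewrite -!EFinD -EFinM -mulrBr mulKf// gt_eqF.
rewrite (H mf) /mscale /= muleA -EFinM divff ?gt_eqF// mul1e.
by [].
Qed.

Lemma lebesgue_measure_reflect (A : set R) : measurable A ->
  lambda [set x | A (1 - x)] = lambda A.
Proof.
move=> mA.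
pose f := (fun x => 1 - x) : measurableTypeR R -> measurableTypeR R.
have mf : measurable_fun [set: measurableTypeR R] f.
  exact: (@measurable_funB _ (measurableTypeR R) _ _ (cst 1) id).
apply/esym; change (lambda A = pushforward lambda f A).
apply: lebesgue_measure_unique mA => _ [[a b]] _ <-.
rewrite /= /pushforward.
(* Reflection exchanges the open and the closed end of the interval; the length is unchanged. *)
rewrite (_ : _ @^-1` _ = `[(1 - b), (1 - a)[%classic); last first.
  by apply/seteqP; split=> x /=; rewrite /f !in_itv/= => /andP[? ?];
    apply/andP; split; lra.
rewrite !lebesgue_measure_itv/= !lte_fin ltrD2l ltrN2.
by case: ifPn => _ //; rewrite -!EFinD; congr EFin; lra.
Qed.

Lemma uniform01_reflect (A : set R) : measurable A ->
  unif [set x | A (1 - x)] = unif A.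
Proof.
move=> mA; rewrite !uniform01E//; last first.
  by rewrite -[X in measurable X]setTI; apply: measurable_funB.
rewrite -[RHS]lebesgue_measure_reflect; last exact: measurableI.
congr (lambda _); apply/seteqP; split=> x /=; rewrite !in_itv/=.
  by move=> -[Ax x01]; split=> //; lra.
by move=> -[Ax x01]; split=> //; lra.
Qed.

Lemma uniform01_set1 (r : R) : unif [set r] = 0%E.
Proof.
rewrite uniform01E//; apply: (subset_measure0 _ _ _ (lebesgue_measure_set1 r)).
- exact: measurableI.
- by [].
- by move=> x [].
Qed.

Lemma uniform01_D1 (r : R) (A : set R) : measurable A ->
  unif (A `\ r) = unif A.
Proof.
move=> mA; have mr : measurable [set r] by [].
have [Ar|Ar] := pselect (A r); last first.
  congr unif; apply/seteqP; split=> x /=; first by case.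
  by move=> Ax; split=> // xr; rewrite -xr in Ar.
rewrite -[in RHS](setD1K Ar) measureU//; last 2 first.
- exact: measurableD.
- by rewrite -subset0 => x /= [-> [_]]; apply.
by rewrite [X in (X + _)%E]uniform01_set1 add0e.
Qed.

Lemma uniform01_lt_scale (v : R) (A : set R) : 0 < v <= 1 -> measurable A ->
  unif [set x | x < v /\ A (x / v)] = (v%:E * unif A)%E.
Proof.
move=> /andP[v0 v1] mA.
have mA1 : measurable (A `\ 1) by exact: measurableD.
have mvA : measurable [set x | x < v /\ A (x / v)].
  rewrite (_ : [set _ | _] = `]-oo, v[ `&` (fun x => x / v) @^-1` A).
    apply: measurableI => //.
    by rewrite -[X in measurable X]setTI; apply: mulrr_measurable.
  by apply/seteqP; split=> x /=; rewrite in_itv.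
(* The strict bound [x < v] becomes [x / v < 1], so the point 1 must first be removed from [A], at
   no cost in measure. *)
rewrite -[in RHS](uniform01_D1 1)// !uniform01E// -lebesgue_measure_scale//; last first.
  exact: measurableI.
congr (lambda _); apply/seteqP; split=> x /=; rewrite !in_itv/=.
  move=> -[[xv Ax] /andP[x0 x1]]; split; last first.
    by rewrite divr_ge0 ?(ltW v0)//= ler_pdivrMr// mul1r ltW.
  by split=> //; apply/eqP; rewrite lt_eqF// ltr_pdivrMr// mul1r.
rewrite ler_pdivrMr// mul1r pmulr_lge0 ?invr_gt0//.
move=> -[[Ax xv1] /andP[x0 xv]].
have xv' : x < v.
  rewrite lt_neqAle xv andbT; apply: contra_notN xv1 => /eqP ->.
  by rewrite divff// gt_eqF.
by split=> //; rewrite x0 (le_trans xv).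
Qed.
End uniform01_prob.

(** * Laws on tuples determined by their values on boxes *)

Section uniform_law.
Context (R : realType).
Local Notation unif := (uniform_prob (@ltr01 R)).
Variable mu : forall n, probability (n.-tuple R) R.
Hypothesis mu_box : forall n (B : 'I_n -> set R), (forall i, measurable (B i)) ->
  mu n (box B) = (\prod_(i < n) unif (B i))%E.

Lemma mu_unique n (m : {measure set (n.-tuple R) -> \bar R}) :
  (forall B : 'I_n -> set R, (forall i, measurable (B i)) ->
    m (box B) = (\prod_(i < n) unif (B i))%E) ->
  forall A, measurable A -> m A = mu n A.
Proof.
move=> mB; apply: tuple_measure_unique => [|B mB'].
  rewrite -boxT mB// big1 ?ltry// => i _.
  exact: probability_setT.
by rewrite mB//; apply/esym/mu_box.
Qed.

(** This is the common end of the changes of variables below: once the integral is written against a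
    pushforward or product measure, only the value of that measure on boxes is left to compute. *)
Lemma eq_mu_integral n (m : {measure set (n.-tuple R) -> \bar R}) F :
  (forall B : 'I_n -> set R, (forall i, measurable (B i)) ->
    m (box B) = (\prod_(i < n) unif (B i))%E) ->
  (\int[mu n]_x F x = \int[m]_x F x)%E.
Proof.
move=> mB; apply: eq_measure_integral => A mA _; apply/esym.
exact: mu_unique.
Qed.

Lemma mu_perm n (s : 'S_n) (F : n.-tuple R -> \bar R) :
  measurable_fun [set: _] F -> (forall x, 0 <= F x)%E ->
  (\int[mu n]_x F [tuple tnth x (s i) | i < n] = \int[mu n]_x F x)%E.
Proof.
move=> mF F0.
pose phi (x : n.-tuple R) := [tuple tnth x (s i) | i < n].
have mphi : measurable_fun setT phi.
  apply/measurable_fun_tnthP => i.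
  rewrite (_ : _ \o _ = fun x => tnth x (s i)); first exact: measurable_tnth.
  by apply/funext => x /=; rewrite tnth_mktuple.
rewrite (ge0_integral_pushforwardT mphi (mu n) mF F0).
apply/esym/eq_mu_integral.
move=> B mB; rewrite /= /pushforward (_ : _ @^-1` _ = box (fun i => B ((s^-1)%g i))).
  rewrite [LHS]mu_box// (reindex_inj (@perm_inj _ s))/=.
  by under eq_bigr do rewrite permK.
apply/seteqP; split=> x /=.
  by move=> Bx i; have := Bx ((s^-1)%g i); rewrite tnth_mktuple permKV.
by move=> Bx i; rewrite tnth_mktuple; have := Bx (s i); rewrite permK.
Qed.

Lemma measurable_cat_tuple p q :
  measurable_fun [set: (p.-tuple R * q.-tuple R)%type]
    (fun z => [tuple of z.1 ++ z.2] : (p + q).-tuple R).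
Proof.
apply/measurable_fun_tnthP => i.
case: (split_ordP i) => j ->.
  rewrite (_ : _ \o _ = fun z => tnth z.1 j).
    by apply: (measurableT_comp (measurable_tnth j)).
  by apply/funext => z /=; rewrite tnth_lshift.
rewrite (_ : _ \o _ = fun z => tnth z.2 j).
  by apply: (measurableT_comp (measurable_tnth j)).
by apply/funext => z /=; rewrite tnth_rshift.
Qed.

(** Concatenation carries the product measure to one that is a product on boxes, and Tonelli splits
    the integral. The right block is the outer variable, matching the outer integral over [v]. *)
Lemma mu_cat p q (F : (p + q).-tuple R -> \bar R) :
  measurable_fun [set: _] F -> (forall x, 0 <= F x)%E ->
  (\int[mu (p + q)]_x F x =
   \int[mu q]_y \int[mu p]_x F [tuple of x ++ y])%E.
Proof.
move=> mF F0.
pose phi (z : p.-tuple R * q.-tuple R) := [tuple of z.1 ++ z.2] : (p + q).-tuple R.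
have mphi : measurable_fun setT phi by exact: measurable_cat_tuple.
rewrite -(@fubini_tonelli2 _ _ _ _ _ (mu p) (mu q) (F \o phi)); last 2 first.
  exact: measurableT_comp.
  by move=> ?; exact: F0.
rewrite (ge0_integral_pushforwardT mphi (mu p \x mu q)%E mF F0).
apply: eq_mu_integral.
move=> B mB; rewrite /= /pushforward (_ : _ @^-1` _ = box (fun i => B (lshift q i))
   `*` box (fun i => B (rshift p i))).
  rewrite [LHS]product_measure1E; [|exact: measurable_box|exact: measurable_box].
  rewrite [X in (X * _)%E]mu_box// [X in (_ * X)%E]mu_box//.
  by rewrite big_split_ord.
apply/seteqP; split=> -[x y] /=.
  move=> Bx; split=> i /=.
    by have := Bx (lshift q i); rewrite tnth_lshift.
  by have := Bx (rshift p i); rewrite tnth_rshift.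
move=> [Bx By] i; case: (split_ordP i) => j ->.
  by rewrite tnth_lshift.
by rewrite tnth_rshift.
Qed.

Lemma measurable_cons_tuple q :
  measurable_fun [set: (measurableTypeR R * q.-tuple R)%type]
    (fun z => [tuple of (z.1 : R) :: z.2] : q.+1.-tuple R).
Proof.
apply/measurable_fun_tnthP => i; case: (unliftP ord0 i) => [j|] ->.
  rewrite (_ : _ \o _ = fun z => tnth z.2 j).
    by apply: (measurableT_comp (measurable_tnth j)).
  by apply/funext => z /=; rewrite tnthS.
rewrite (_ : _ \o _ = fst) => [_ B mB|].
  exact: (@measurable_fst _ _ (measurableTypeR R) (q.-tuple R)).
by apply/funext => z /=; rewrite tnth0.
Qed.

Lemma mu_cons q (F : q.+1.-tuple R -> \bar R) :
  measurable_fun [set: _] F -> (forall x, 0 <= F x)%E ->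
  (\int[mu q.+1]_x F x =
   \int[unif]_u \int[mu q]_y F [tuple of u :: y])%E.
Proof.
move=> mF F0.
pose phi (z : measurableTypeR R * q.-tuple R) : q.+1.-tuple R :=
  [tuple of (z.1 : R) :: z.2].
have mphi : measurable_fun setT phi by exact: measurable_cons_tuple.
rewrite -(@fubini_tonelli1 _ _ _ _ _ unif (mu q) (F \o phi)); last 2 first.
  exact: measurableT_comp.
  by move=> ?; exact: F0.
rewrite (ge0_integral_pushforwardT mphi (unif \x mu q)%E mF F0).
apply: eq_mu_integral.
move=> B mB; rewrite /= /pushforward (_ : _ @^-1` _ = B ord0
   `*` box (fun i => B (lift ord0 i))).
  rewrite [LHS]product_measure1E; [|exact: mB|exact: measurable_box].
  rewrite [X in (_ * X)%E]mu_box//.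
  by rewrite big_ord_recl.
apply/seteqP; split=> -[x y] /=.
  move=> Bx; split=> [|i] /=; first by have := Bx ord0; rewrite tnth0.
  by have := Bx (lift ord0 i); rewrite tnthS.
by move=> [Bx By] i; case: (unliftP ord0 i) => [j|] ->; rewrite ?tnthS ?tnth0.
Qed.

End uniform_law.

(** * Measurability of sorting *)

Section tuple_measurability.
Context (R : realType).

Lemma measurable_fun_all d (X : measurableType d) (I : Type) (s : seq I)
    (b : I -> X -> bool) : (forall i, measurable_fun setT (b i)) ->
  measurable_fun setT (fun x => all (b ^~ x) s).
Proof.
move=> mb; elim: s => [|i s ih] /=; first exact: measurable_cst.
exact: measurable_and.
Qed.

Lemma measurable_tuple_nth n i :
  measurable_fun [set: n.-tuple R] (fun x => nth 0 x i).
Proof.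
have [ni|ni] := leqP n i.
  rewrite (_ : (fun x => _) = cst 0); first exact: measurable_cst.
  by apply/funext => x; rewrite nth_default// size_tuple.
rewrite (_ : (fun x => _) = (@tnth n R)^~ (Ordinal ni)).
  exact: measurable_tnth.
by apply/funext => x; rewrite (tnth_nth 0).
Qed.

Lemma measurable_tuple_last n :
  measurable_fun [set: n.-tuple R] (fun x => last 0 x).
Proof.
case: n => [|n].
  rewrite (_ : (fun x => _) = cst 0); first exact: measurable_cst.
  by apply/funext => x; rewrite tuple0.
rewrite (_ : (fun x => _) = (fun x : n.+1.-tuple R => nth 0 x n)).
  exact: measurable_tuple_nth.
by apply/funext => x; rewrite (last_nth 0) size_tuple.
Qed.

Lemma measurable_tuple_path n (r : rel R) (a : R) :
  (forall (X := n.-tuple R) (f g : X -> R), measurable_fun setT f ->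
    measurable_fun setT g -> measurable_fun setT (fun x => r (f x) (g x))) ->
  measurable_fun [set: n.-tuple R] (fun x => path r a x).
Proof.
move=> mr.
rewrite (_ : (fun x => _) = (fun x : n.-tuple R =>
    all (fun i => r (nth 0 (a :: x) i) (nth 0 x i)) (iota 0 n))).
  apply: measurable_fun_all => -[|i]; apply: mr => //=; exact: measurable_tuple_nth.
apply/funext => x; apply/idP/allP.
  by move=> /(pathP 0) h i; rewrite mem_iota add0n => /= ni; apply: h; rewrite size_tuple.
move=> h; apply/(pathP 0) => i; rewrite size_tuple => ni.
by apply: h; rewrite mem_iota.
Qed.

Lemma measurable_tuple_sorted n :
  measurable_fun [set: n.-tuple R] (fun x => sorted <=%R (x : seq R)).
Proof.
rewrite (_ : (fun x => _) = (fun x : n.-tuple R =>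
    all (fun i => nth 0 x i <= nth 0 x i.+1) (iota 0 n.-1))).
  by apply: measurable_fun_all => i; apply: measurable_fun_ler;
    exact: measurable_tuple_nth.
apply/funext => x; apply/idP/allP.
  move=> /(sortedP 0) h i; rewrite mem_iota add0n => /= ni.
  by apply: h; rewrite size_tuple -ltn_predRL.
move=> h; apply/(sortedP 0) => i; rewrite size_tuple => ni.
by apply: h; rewrite mem_iota add0n ltn_predRL.
Qed.

Lemma measurable_tuple_perm n (s : 'S_n) :
  measurable_fun [set: n.-tuple R] (fun x => [tuple tnth x (s i) | i < n]).
Proof.
apply/measurable_fun_tnthP => i.
rewrite (_ : _ \o _ = fun x => tnth x (s i)); first exact: measurable_tnth.
by apply/funext => x /=; rewrite tnth_mktuple.
Qed.

Lemma sort_permE n (x : n.-tuple R) : exists s : 'S_n,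
  sort <=%R x = [tuple tnth x (s i) | i < n].
Proof.
have /tuple_permP[s hs] : perm_eq (sort_tuple <=%R x) x by rewrite perm_sort.
by exists s; rewrite -hs.
Qed.

(** Sorting is a coordinate permutation on each of finitely many measurable pieces, so a preimage is
    a finite union, over the permutations [s], of the tuples that [s] sorts into the preimage under
    [F]. *)
Lemma measurable_tuple_sort d (Y : measurableType d) n (F : seq R -> Y) :
  measurable_fun [set: n.-tuple R] (fun x => F x) ->
  measurable_fun [set: n.-tuple R] (fun x => F (sort <=%R x)).
Proof.
move=> mF _ B mB; rewrite setTI.
pose ps (s : 'S_n) (x : n.-tuple R) := [tuple tnth x (s i) | i < n].
rewrite (_ : _ @^-1` B = \bigcup_(s in [set: 'S_n])
   (ps s @^-1` ([set x : n.-tuple R | sorted <=%R (x : seq R)] `&`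
     (fun x : n.-tuple R => F x) @^-1` B))).
  apply: fin_bigcup_measurable => [|s _]; first exact: finite_finset.
  rewrite -[X in measurable X]setTI; apply: measurable_tuple_perm => //.
  apply: measurableI.
    have := @measurable_tuple_sorted n measurableT [set true].
    by rewrite setTI; apply.
  by rewrite -[X in measurable X]setTI; exact: mF.
apply/seteqP; split=> x /=.
  move=> Bx; have [s hs] := sort_permE x; exists s => //=.
  by rewrite -hs; split=> //; apply: sort_sorted; exact: le_total.
move=> [s _ [/= ss Bs]].
rewrite (_ : sort _ _ = ps s x)//; apply: (sorted_eq le_trans le_anti) => //.
  by apply: sort_sorted; exact: le_total.
rewrite perm_sort perm_sym; apply/tuple_permP; by exists s.
Qed.

End tuple_measurability.

(** * Chains *)

Section chains.
Context (R : realType).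
Implicit Types (t u v : R) (s x y : seq R).

(* [D_j - U_{j-1} <= t] is [step t U_{j-1} U_j]. *)
Definition step t : rel R := fun p q => q <= 2 * p + t.
(** No final step to 1 is required, because the maxima in [travel_time] stop at [j = n]; the version
    with that step is [full_chain]. *)
Definition chain t s := path (step t) 0 (sort <=%R s).
Definition maxpt s := last 0 (sort <=%R s).
Definition reflected s := [seq 1 - z | z <- s].

Lemma eq_sort s s' : perm_eq s s' -> sort <=%R s = sort <=%R s'.
Proof.
by move=> ss'; apply/perm_sortP => //;
  [exact: le_total|exact: le_trans|exact: le_anti].
Qed.

Lemma perm_sorted_sort s s' : sorted <=%R s' -> perm_eq s' s -> sort <=%R s = s'.
Proof.
move=> s's ps; apply: (sorted_eq le_trans le_anti) => //.
  by apply: sort_sorted; exact: le_total.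
by rewrite perm_sort perm_sym.
Qed.

Lemma chain_perm t s s' : perm_eq s s' -> chain t s = chain t s'.
Proof. by move=> ss'; rewrite /chain (eq_sort ss'). Qed.

Lemma mx_perm s s' : perm_eq s s' -> maxpt s = maxpt s'.
Proof. by move=> ss'; rewrite /maxpt (eq_sort ss'). Qed.

Lemma sort_le_sorted s : sorted <=%R (sort <=%R s).
Proof. by apply: sort_sorted; exact: le_total. Qed.

Lemma sort_refl s : sort <=%R (reflected s) = rev (reflected (sort <=%R s)).
Proof.
apply: perm_sorted_sort; last first.
  by rewrite perm_rev perm_map// perm_sort.
rewrite rev_sorted sorted_map.
by apply: sub_sorted (sort_le_sorted s) => p q /= pq; rewrite lerD2l lerN2.
Qed.

Lemma reflK s : reflected (reflected s) = s.
Proof. by rewrite /reflected -map_comp map_id_in// => z _ /=; rewrite subKr. Qed.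

Lemma sort_rcons_lt v s : all (fun z => z < v) s ->
  sort <=%R (v :: s) = rcons (sort <=%R s) v.
Proof.
move=> sv; apply: perm_sorted_sort; last by rewrite perm_rcons perm_cons perm_sort.
rewrite -cats1 (sorted_pairwise le_trans) pairwise_cat -(sorted_pairwise le_trans).
rewrite sort_le_sorted/= andbT allrel1r all_sort.
by apply: sub_all sv => z /ltW.
Qed.

Lemma mx_cons_lt v s : all (fun z => z < v) s -> maxpt (v :: s) = v.
Proof. by move=> sv; rewrite /maxpt sort_rcons_lt// last_rcons. Qed.

Lemma sort_scale v s : 0 < v ->
  sort <=%R [seq z / v | z <- s] = [seq z / v | z <- sort <=%R s].
Proof.
move=> v0; apply: perm_sorted_sort; last by rewrite perm_map// perm_sort.
rewrite sorted_map; apply: sub_sorted (sort_le_sorted s) => p q /= pq.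
by rewrite ler_pM2r// invr_gt0.
Qed.

(** The relation [q <= 2 p + t] is homogeneous when [t] scales along with the points: division by
    [v] fixes the start 0, sends the end point [v] to 1 and gives the event behind [P_m (t / v)]. *)
Lemma chain_cons_scale t v s : 0 < v -> all (fun z => z < v) s ->
  chain t (v :: s) =
  path (step (t / v)) 0 (rcons (sort <=%R [seq z / v | z <- s]) 1).
Proof.
move=> v0 sv; rewrite /chain sort_rcons_lt// sort_scale//.
have -> : rcons [seq z / v | z <- sort <=%R s] 1 =
          [seq z / v | z <- rcons (sort <=%R s) v].
  by rewrite map_rcons divff// gt_eqF.
have := @path_map _ _ (fun z => z / v) (step (t / v)) 0 (rcons (sort <=%R s) v).
rewrite /= mul0r => ->; apply: eq_path => p q /=.
by rewrite /step mulrA -mulrDl ler_pM2r// invr_gt0.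
Qed.

Lemma path_step_trivial t p s : 0 <= t -> 2^-1 <= p ->
  all (fun z => 2^-1 <= z <= 1) s -> path (step t) p s.
Proof.
move=> t0; elim: s p => //= z s ih p hp /andP[/andP[hz hz1] hs].
by rewrite ih// andbT /step; lra.
Qed.

(** The sorted list is the left block followed by the mirrored right block, whose first entry is
    [1 - maxpt y]. Only the step across the middle imposes a condition, since later ones start at or
    after 1/2. For empty [x] the crossing starts at [maxpt [::] = 0]. *)
Lemma chain_cat_refl t x y : 0 <= t -> y != [::] ->
  all (fun z => 0 <= z <= 2^-1) x -> all (fun z => 0 <= z <= 2^-1) y ->
  chain t (x ++ reflected y) = chain t x && (1 - maxpt y <= 2 * maxpt x + t).
Proof.
move=> t0 y0 hx hy; rewrite /chain.
have -> : sort <=%R (x ++ reflected y) = sort <=%R x ++ sort <=%R (reflected y).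
  apply: perm_sorted_sort; last by rewrite perm_cat ?perm_sort.
  rewrite (sorted_pairwise le_trans) pairwise_cat -!(sorted_pairwise le_trans).
  rewrite !sort_le_sorted !andbT; apply/allrelP => p q.
  rewrite !mem_sort => /(allP hx)/= hp /mapP[q' /(allP hy)/= hq' ->]; lra.
rewrite cat_path; congr (_ && _); rewrite sort_refl /maxpt.
have : all (fun z => 0 <= z <= 2^-1) (sort <=%R y) by rewrite all_sort.
have : sort <=%R y != [::] by rewrite -size_eq0 size_sort size_eq0.
case/lastP: (sort <=%R y) => // s m _.
rewrite /reflected map_rcons rev_rcons all_rcons last_rcons /= => /andP[hm hs].
rewrite path_step_trivial ?andbT//; first by lra.
by rewrite all_rev all_map; apply: sub_all hs => z /=; lra.
Qed.

(** Mirroring the sample exchanges the roles of [x] and [y] up to a permutation. The two crossing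
    conditions differ only in subtracting [maxpt x] or [maxpt y] once more, so the smaller of the
    two is decisive. *)
Lemma chain_both t x y : 0 <= t -> x != [::] -> y != [::] ->
  all (fun z => 0 <= z <= 2^-1) x -> all (fun z => 0 <= z <= 2^-1) y ->
  chain t (x ++ reflected y) && chain t (reflected (x ++ reflected y)) =
  [&& chain t x, chain t y & 1 - maxpt y - maxpt x - Num.min (maxpt x) (maxpt y) <= t].
Proof.
move=> t0 x0 y0 hx hy.
have -> : chain t (reflected (x ++ reflected y)) = chain t (y ++ reflected x).
  apply: chain_perm; rewrite /reflected map_cat -/(reflected _).
  rewrite -/(reflected (reflected y)) reflK.
  by rewrite perm_catC.
rewrite !chain_cat_refl//; case: (chain t x) => //=.
case: (chain t y) => //=; last by rewrite andbF.
have [h|h] := leP (maxpt x) (maxpt y); apply/andP/idP => [[h1 h2]|h']; (try split); lra.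
Qed.

Lemma chain_refl t x : 0 <= t -> x != [::] ->
  all (fun z => 0 <= z <= 2^-1) x -> chain t (reflected x) = (1 - maxpt x <= t).
Proof.
move=> t0 x0 hx; rewrite -[reflected x]cat0s chain_cat_refl//.
by rewrite /chain /maxpt/= mulr0 add0r.
Qed.

Lemma max_1_to_le n (F : nat -> R) t : (0 < n)%N ->
  (max_1_to n F <= t) <-> (forall j, (0 < j <= n)%N -> F j <= t).
Proof.
move=> n0; rewrite /max_1_to big_nat; split.
  move=> h j jn; apply: le_trans h.
  by apply: (@le_bigmax_seq _ _ _ _ _ j) => //; rewrite mem_index_iota ltnS.
by move=> h; apply: bigmax_le => [|j]; [apply: h; rewrite n0|rewrite ltnS; exact: h].
Qed.

Lemma path_stepP t s : path (step t) 0 s <->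
  (forall j, (0 < j <= size s)%N ->
    nth 0 (0 :: s) j - nth 0 (0 :: s) j.-1 - nth 0 (0 :: s) j.-1 <= t).
Proof.
split.
  move=> /(pathP 0) h [|j]// /andP[_ js]; have := h j js; rewrite /step /=; lra.
move=> h; apply/(pathP 0) => i si; have := h i.+1 si; rewrite /step/=; lra.
Qed.

Lemma travel_time_ge n (x : 'I_n -> R) t : (0 < n)%N ->
  let s := [seq x j | j <- enum 'I_n] in
  (1 - t <= travel_time x) = chain t s && chain t (reflected s).
Proof.
move=> n0 s; rewrite /travel_time lerD2l lerN2 ge_max.
have ss : size (sort <=%R s) = n by rewrite size_sort size_map size_enum_ord.
congr (_ && _).
  apply/idP/idP.
    (* Here [j <= n], so the closing entry 1 of [ordstat] is never read. *)
    move=> /(max_1_to_le _ _ n0) h; apply/path_stepP => j; rewrite ss => jn.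
    have := h j jn; rewrite /spacing /ordstat -rcons_cons !nth_rcons/= ss.
    by case/andP: jn => j0 jn; rewrite ltnS jn ltnS (leq_trans (leq_pred j)).
  move=> /path_stepP; rewrite ss => h; apply/(max_1_to_le _ _ n0) => j jn.
  have := h j jn; rewrite /spacing /ordstat -rcons_cons !nth_rcons/= ss.
  by case/andP: jn => j0 jn; rewrite ltnS jn ltnS (leq_trans (leq_pred j)).
(* The mirrored order statistics are [1 - U_{n+1-j}]; at [j = 0] the closing entry [U_{n+1} = 1]
   becomes the start 0. *)
have nthL j : (j <= n)%N -> nth 0 (0 :: rev (reflected (sort <=%R s))) j =
    1 - nth 0 (0 :: rcons (sort <=%R s) 1) (n.+1 - j).
  move=> jn; rewrite (_ : 0 :: rev _ = rev (reflected (rcons (sort <=%R s) 1))).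
    rewrite nth_rev size_map size_rcons ss; last by rewrite ltnS.
    rewrite (nth_map 0) ?size_rcons ?ss ?subSS; last by rewrite ltnS leq_subr.
    by rewrite subSn.
  by rewrite /reflected map_rcons subrr rev_rcons.
rewrite /chain sort_refl; have sr : size (rev (reflected (sort <=%R s))) = n.
  by rewrite size_rev size_map.
have E j : (0 < j <= n)%N ->
   spacing x (n.+2 - j) - (1 - ordstat x (n.+2 - j)) =
   nth 0 (0 :: rev (reflected (sort <=%R s))) j -
   nth 0 (0 :: rev (reflected (sort <=%R s))) j.-1 -
   nth 0 (0 :: rev (reflected (sort <=%R s))) j.-1.
  move=> /andP[j0 jn]; rewrite !nthL//; last exact: leq_trans (leq_pred j) jn.
  rewrite /spacing /ordstat -/s.
  have -> : (n.+2 - j).-1 = (n.+1 - j)%N by rewrite subSn // leqW.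
  have -> : (n.+1 - j.-1 = n.+2 - j)%N by rewrite -[in RHS](prednK j0) subSS.
  lra.
apply/idP/idP.
  move=> /(max_1_to_le _ _ n0) h; apply/path_stepP => j; rewrite sr => jn.
  by rewrite -E//; exact: h.
move=> /path_stepP; rewrite sr => h; apply/(max_1_to_le _ _ n0) => j jn.
by rewrite E//; exact: h.
Qed.

Lemma max_spacing_le m (x : 'I_m -> R) t :
  (max_1_to m.+1 (fun j => spacing x j - ordstat x j.-1) <= t) =
  path (step t) 0 (rcons (sort <=%R [seq x j | j <- enum 'I_m]) 1).
Proof.
set s := rcons _ _.
have ss : size s = m.+1 by rewrite size_rcons size_sort size_map size_enum_ord.
apply/idP/idP.
  by move=> /max_1_to_le h; apply/path_stepP => j; rewrite ss => jn; exact: h.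
by move=> /path_stepP h; apply/max_1_to_le => // j jn; apply: h; rewrite ss.
Qed.

Lemma step_le t t' p q : t <= t' -> step t p q -> step t' p q.
Proof. by rewrite /step => tt' h; apply: le_trans h _; rewrite lerD2l. Qed.

End chains.

(** * Reflection, scaling and null sets for uniform tuples *)

Section uniform_law2.
Context (R : realType).
Local Notation unif := (uniform_prob (@ltr01 R)).
Variable mu : forall n, probability (n.-tuple R) R.
Hypothesis mu_box : forall n (B : 'I_n -> set R), (forall i, measurable (B i)) ->
  mu n (box B) = (\prod_(i < n) unif (B i))%E.

Lemma mu_refl n (F : seq R -> \bar R) :
  measurable_fun [set: n.-tuple R] (fun x => F x) -> (forall x, 0 <= F x)%E ->
  (\int[mu n]_x F (reflected x) = \int[mu n]_x F x)%E.
Proof.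
move=> mF F0.
pose phi (x : n.-tuple R) := map_tuple (fun z => 1 - z) x.
have mphi : measurable_fun setT phi.
  apply/measurable_fun_tnthP => i.
  rewrite (_ : _ \o _ = fun x => 1 - tnth x i).
    by apply: measurable_funB => //; exact: measurable_tnth.
  by apply/funext => x /=; rewrite tnth_map.
rewrite (ge0_integral_pushforwardT mphi (mu n) mF)//.
apply/esym/(eq_mu_integral mu_box) => B mB; rewrite /= /pushforward.
rewrite (_ : _ @^-1` _ = box (fun i => [set z | B i (1 - z)])).
  rewrite [LHS]mu_box//; first by apply: eq_bigr => i _; rewrite uniform01_reflect.
  by move=> i; rewrite -[X in measurable X]setTI; apply: measurable_funB.
by apply/seteqP; split=> x /= Bx i; have := Bx i; rewrite tnth_map.
Qed.

Lemma mu_all1 n (B : set R) : measurable B -> unif B = 1%E ->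
  mu n [set x | forall i, B (tnth x i)] = 1%E.
Proof.
move=> mB B1; rewrite (_ : [set _ | _] = box (fun=> B))//.
by rewrite [LHS]mu_box// big1.
Qed.

Lemma ae_mu_all n (B : set R) : measurable B -> unif B = 1%E ->
  {ae mu n, forall x, forall i, B (tnth x i)}.
Proof.
move=> mB B1; have mbox := @measurable_box R n (fun=> B) (fun=> mB).
exists (~` box (fun=> B)); split.
- exact: measurableC.
- by rewrite probability_setC// [X in (_ - X)%E]mu_all1// subee.
- by move=> x.
Qed.

(** This replaces conditioning on all points being below [v]: restrict [mu n] to that event, push
    forward by division by [v] and rescale by [v^-n]. The result agrees with [mu n] on boxes, hence
    everywhere. *)
Lemma mu_lt_scale n (v : R) (A : set (n.-tuple R)) : 0 < v <= 1 ->
  measurable A ->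
  mu n [set x : n.-tuple R | all (fun z => z < v) x /\
                A (map_tuple (fun z => z / v) x)] = ((v ^+ n)%:E * mu n A)%E.
Proof.
move=> v01 mA; have /andP[v0 v1] := v01.
pose phi (x : n.-tuple R) := map_tuple (fun z => z / v) x.
have mphi : measurable_fun setT phi.
  apply/measurable_fun_tnthP => i.
  rewrite (_ : _ \o _ = fun x => tnth x i / v).
    by apply: measurable_funM => //; exact: measurable_tnth.
  by apply/funext => x /=; rewrite tnth_map.
pose L := [set x : n.-tuple R | all (fun z => z < v) x].
have mL : measurable L.
  rewrite (_ : L = box (fun=> `]-oo, v[%classic)); first exact: measurable_box.
  apply/seteqP; split=> x /=.
    by move=> /all_tnthP h i; rewrite /= in_itv/= h.
  by move=> h; apply/all_tnthP => i; have := h i; rewrite /= ?in_itv.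
have vn0 : 0 <= (v ^+ n)^-1 by rewrite invr_ge0 exprn_ge0// ltW.
have H : forall A, measurable A ->
    mscale (NngNum vn0) (pushforward (mrestr (mu n) mL) phi) A = mu n A.
  move=> ?; apply: (mu_unique mu_box) => B mB.
  rewrite /= /mscale /= /pushforward /mrestr.
  rewrite (_ : _ `&` _ = box (fun i => [set z | z < v /\ B i (z / v)])).
    rewrite [X in (_ * X)%E]mu_box; last first.
      move=> i; rewrite (_ : [set _ | _] = `]-oo, v[ `&` (fun x => x / v) @^-1` B i).
        apply: measurableI => //.
        by rewrite -[X in measurable X]setTI; apply: mulrr_measurable.
      by apply/seteqP; split=> x /=; rewrite in_itv.
    rewrite (eq_bigr (fun i => v%:E * unif (B i))%E); last first.
      by move=> i _; exact: uniform01_lt_scale.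
    rewrite big_split/= muleA -[RHS]mul1e; congr (_ * _)%E.
    rewrite prodEFin prodr_const card_ord -EFinM mulVf// expf_neq0//.
    by rewrite gt_eqF.
  apply/seteqP; split=> x /=.
    by move=> [h /all_tnthP L1] i; split=> //; have := h i; rewrite tnth_map.
  move=> h; split; last by apply/all_tnthP => i; have [] := h i.
  by move=> i; rewrite tnth_map; have [] := h i.
rewrite -[X in (_ * X)%E](H mphi)// /mscale /= /pushforward /mrestr muleA.
rewrite -EFinM divff ?mul1e.
  by congr (mu n _); apply/seteqP; split=> x /= [].
by rewrite expf_neq0// gt_eqF.
Qed.

Lemma measurable_tuple_uniq n :
  measurable_fun [set: n.-tuple R] (fun x => uniq (x : seq R)).
Proof.
rewrite (_ : (fun x => _) = (fun x : n.-tuple R =>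
    all (fun i => all (fun j => (i == j) || (tnth x i != tnth x j)) (enum 'I_n))
      (enum 'I_n))).
  apply: measurable_fun_all => i; apply: measurable_fun_all => j.
  apply: measurable_or => //; apply: measurable_neg.
  by apply: measurable_fun_eqr; exact: measurable_tnth.
apply/funext => x; apply/tuple_uniqP/allP.
  move=> h i _; apply/allP => j _; case: eqVneq => //= ij.
  by apply: contra_neq ij; exact: h.
move=> h i j xij; have /allP/(_ j) := h i (mem_enum _ _).
by rewrite mem_enum xij eqxx orbF => /(_ isT)/eqP.
Qed.

Lemma ge0_integral_bool0 d (X : measurableType d) (m : {measure set X -> \bar R})
    (b : X -> bool) : {ae m, forall x, ~~ b x} -> measurable_fun setT b ->
  (\int[m]_x (b x)%:R%:E = 0)%E.
Proof.
move=> ab mb; rewrite (@ae_eq_integral _ _ _ _ _ (cst 0%E))//; first exact: integral0.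
  apply/measurable_EFinP; rewrite (_ : (fun x => _) = (fun b : bool => b%:R : R) \o b)//.
  exact: measurableT_comp.
by apply: filterS ab => x /negbTE /= ->.
Qed.

Lemma uniform01_setC1 (r : R) : unif [set~ r] = 1%E.
Proof. by rewrite -setTD uniform01_D1//; exact: probability_setT. Qed.

Lemma measurable_boolR d (X : measurableType d) (b : X -> bool) :
  measurable_fun setT b -> measurable_fun setT (fun x => (b x)%:R%:E : \bar R).
Proof.
move=> mb; apply/measurable_EFinP.
rewrite (_ : (fun x => _) = (fun b : bool => b%:R : R) \o b)//.
exact: measurableT_comp.
Qed.

Lemma integral_boolR d (X : measurableType d) (m : {measure set X -> \bar R})
    (b : X -> bool) : measurable_fun setT b ->
  (\int[m]_x (b x)%:R%:E = m [set x | b x])%E.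
Proof.
move=> mb; rewrite -[X in m X]setIT -integral_indic//.
  by apply: eq_integral => x _; rewrite indicE (_ : (x \in _) = b x)//;
    apply/idP/idP; rewrite inE.
by have := mb measurableT [set true]; rewrite setTI; apply.
Qed.

(** By induction, with the head [u] fixed: almost every tail has distinct entries, and almost every
    tail avoids the single value [u]. *)
Lemma ae_mu_uniq n : {ae mu n, forall x : n.-tuple R, uniq x}.
Proof.
elim: n => [|n ih].
  by apply: aeW => x; rewrite tuple0.
have mN : measurable_fun [set: n.+1.-tuple R] (fun x => ~~ uniq (x : seq R)).
  by apply: measurable_neg; exact: measurable_tuple_uniq.
exists [set x : n.+1.-tuple R | ~~ uniq x]; split.
- by have := mN measurableT [set true]; rewrite setTI; apply.
- rewrite -[LHS](integral_boolR _ mN) (mu_cons mu_box)//; last exact: measurable_boolR.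
  rewrite integral0_eq// => u _; apply: ge0_integral_bool0.
    have := ae_mu_all n (measurableC (measurable_set1 u)) (uniform01_setC1 u).
    apply: filterS2 ih => y yU /= uy; rewrite yU andbT negbK.
    by apply/negP => /tnthP[i ui]; exact: (uy i).
  have : measurable_fun setT (fun y : n.-tuple R => [tuple of u :: y]).
    by apply: measurable_cons.
  by move=> h; exact: (measurableT_comp mN h).
- by move=> x /= /negP.
Qed.

End uniform_law2.

(** * Law of the maximum of a chain *)

Section maximum_law.
Context (R : realType).
Local Notation unif := (uniform_prob (@ltr01 R)).
Local Notation lambda := (@lebesgue_measure R).
Variable mu : forall n, probability (n.-tuple R) R.
Hypothesis mu_box : forall n (B : 'I_n -> set R), (forall i, measurable (B i)) ->
  mu n (box B) = (\prod_(i < n) unif (B i))%E.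

Lemma measurable_step (t : R) d (X : measurableType d) (f g : X -> R) :
  measurable_fun setT f -> measurable_fun setT g ->
  measurable_fun setT (fun x => step t (f x) (g x)).
Proof.
move=> mf mg; apply: measurable_fun_ler => //.
by apply: measurable_funD => //; apply: measurable_funM.
Qed.

Lemma measurable_chain t n :
  measurable_fun [set: n.-tuple R] (fun x => chain t x).
Proof.
apply: (@measurable_tuple_sort _ _ _ _ (path (step t) 0)).
by apply: measurable_tuple_path => X f g; exact: measurable_step.
Qed.

Lemma measurable_mx n : measurable_fun [set: n.-tuple R] (fun x => maxpt x).
Proof.
apply: (@measurable_tuple_sort _ _ _ _ (last 0)).
exact: measurable_tuple_last.
Qed.

(* The event whose probability is [P_m t], for a sorted sample closed by
   [U_{m+1:m} = 1]. *)
Definition full_chain (t : R) (s : seq R) := path (step t) 0 (rcons (sort <=%R s) 1).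

Lemma measurable_full_chain t n :
  measurable_fun [set: n.-tuple R] (fun x => full_chain t x).
Proof.
rewrite (_ : (fun x => _) = (fun x : n.-tuple R =>
    chain t x && step t (maxpt x) 1)); last first.
  by apply/funext => x; rewrite /full_chain rcons_path.
apply: measurable_and; first exact: measurable_chain.
by apply: measurable_step => //; exact: measurable_mx.
Qed.

Lemma measurable_tuple_all n (p : R -> bool) : measurable_fun setT p ->
  measurable_fun [set: n.-tuple R] (fun x => all p x).
Proof.
move=> mp; rewrite (_ : (fun x => _) = (fun x : n.-tuple R =>
    all (fun i => p (tnth x i)) (enum 'I_n))).
  by apply: measurable_fun_all => i; apply: (measurableT_comp mp (measurable_tnth i)).
apply/funext => x; apply/all_tnthP/allP => [h i _|h i]; first exact: h.
by apply: h; rewrite mem_enum.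
Qed.

Definition in_half (z : R) := 0 <= z <= 2^-1.

Lemma measurable_in_half : measurable_fun setT in_half.
Proof. by apply: measurable_and; apply: measurable_fun_ler. Qed.

Definition good_chain t s := all in_half s && chain t s.

Lemma measurable_good t n : measurable_fun [set: n.-tuple R] (fun x => good_chain t x).
Proof.
apply: measurable_and; last exact: measurable_chain.
by apply: measurable_tuple_all; exact: measurable_in_half.
Qed.

Lemma good_perm t s s' : perm_eq s s' -> good_chain t s = good_chain t s'.
Proof. by move=> ss'; rewrite /good_chain (chain_perm t ss') (perm_all _ ss'). Qed.

Definition is_top n (x : n.-tuple R) (i : 'I_n) :=
  all (fun j => (i == j) || (tnth x j < tnth x i)) (enum 'I_n).

Lemma topP n (x : n.-tuple R) (i : 'I_n) :
  reflect (forall j, i != j -> tnth x j < tnth x i) (is_top x i).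
Proof.
apply: (iffP allP) => [h j ij|h j _].
  by have := h j (mem_enum _ _); rewrite (negbTE ij).
by case: eqVneq => //= ij; exact: h.
Qed.

Lemma measurable_top n (i : 'I_n) :
  measurable_fun setT (fun x : n.-tuple R => is_top x i).
Proof.
apply: measurable_fun_all => j; apply: measurable_or => //.
by apply: measurable_fun_ltr; exact: measurable_tnth.
Qed.

(** Without ties exactly one coordinate is a strict maximum, so these indicators form a partition of
    unity along which an integral can be split. *)
Lemma sum_top n (x : n.+1.-tuple R) : uniq x ->
  \sum_(i < n.+1) (is_top x i)%:R = 1 :> R.
Proof.
move=> /tuple_uniqP xU.
have [i _ hi] := @arg_maxP _ _ _ ord0 xpredT (tnth x) isT.
have {}hi j : tnth x j <= tnth x i by exact: hi.
have ti : is_top x i.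
  apply/topP => j ij; rewrite lt_neqAle hi// andbT.
  by apply: contra_neq ij => /xU.
rewrite (bigD1 i)//= ti big1 ?addr0// => j ji.
case: topP => // /(_ i ji) /lt_le_trans/(_ (hi j)).
by rewrite ltxx.
Qed.

Lemma top_perm n (x : n.-tuple R) (s : 'S_n) i :
  is_top [tuple tnth x (s j) | j < n] i = is_top x (s i).
Proof.
apply/topP/topP => h j ij.
  have := h ((s^-1)%g j); rewrite !tnth_mktuple permKV; apply.
  by apply: contra_neq ij => ->; rewrite permKV.
rewrite !tnth_mktuple; apply: h; by rewrite (inj_eq perm_inj).
Qed.

Lemma top_cons n (u : R) (y : n.-tuple R) :
  is_top [tuple of u :: y] ord0 = all (fun z => z < u) y.
Proof.
apply/topP/all_tnthP => h i.
  by have := h (lift ord0 i) isT; rewrite tnth0 tnthS.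
by case: (unliftP ord0 i) => [j|] -> // _; rewrite tnth0 tnthS.
Qed.

(* [p q] is [P_q]; it is tied to the law only away from [1], because [P_0] is
   defined with a strict inequality. *)
Variable p : nat -> R -> R.
Hypothesis p_nd : forall q, {homo p q : s s' / s <= s'}.
Hypothesis p_ge0 : forall q s, 0 <= p q s.
Hypothesis pE : forall q s, s != 1 ->
  (p q s)%:E = mu q [set x : q.-tuple R | full_chain s x].

Lemma measurable_invr : measurable_fun setT (@GRing.inv R).
Proof.
rewrite -(setvU [set 0]); apply/measurable_funU => //.
  exact: measurableC.
split; last exact: measurable_fun_set1.
apply: open_continuous_measurable_fun => [|x].
  exact/closed_openC/closed_eq.
rewrite inE/= => /eqP; exact: inv_continuous.
Qed.

(** Monotonicity of [p q] in the threshold makes it Borel; at [u = 0] the quotient is 0 by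
    convention. *)
Lemma measurable_p_div q (t : R) : measurable_fun setT (fun u : R => p q (t / u)).
Proof.
apply: (@measurableT_comp _ _ _ _ _ _ (p q)).
  by apply: nondecreasing_measurable.
by apply: measurable_funM => //; exact: measurable_invr.
Qed.

Variable t : R.
Variable h : R -> \bar R.
Hypothesis mh : measurable_fun setT h.
Hypothesis h_ge0 : forall u, (0 <= h u)%E.

(** The weight [h] is left free because the other block enters only through the maximum: [h] will be
    a crossing indicator for the left block and an already integrated left block for the right
    one. *)
Definition mxfun s := ((good_chain t s)%:R%:E * h (maxpt s))%E.

Lemma measurable_mxfun n : measurable_fun [set: n.-tuple R] (fun x => mxfun x).
Proof.
apply: emeasurable_funM; first by apply: measurable_boolR; exact: measurable_good.
exact: (measurableT_comp mh (@measurable_mx n)).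
Qed.

Lemma mxfun_ge0 s : (0 <= mxfun s)%E.
Proof. by rewrite mule_ge0// lee_fin. Qed.

Lemma mxfun_perm s s' : perm_eq s s' -> mxfun s = mxfun s'.
Proof. by move=> ss'; rewrite /mxfun (good_perm t ss') (mx_perm ss'). Qed.

Definition slice q (u : R) : \bar R :=
  (\int[mu q]_y ((is_top [tuple of u :: y] ord0)%:R%:E * mxfun (u :: y)))%E.

Lemma ae_mu_ge0 q : {ae mu q, forall y : q.-tuple R, all (fun z => 0 <= z) y}.
Proof.
have m1 : unif `[0, +oo[%classic = 1%E.
  rewrite uniform01E// (_ : _ `&` _ = `[0, 1]%classic).
    by rewrite lebesgue_measure_itv/= lte_fin ltr01 oppr0 adde0.
  by apply/seteqP; split=> z /=; rewrite !in_itv/= ?andbT; [case|move=> /andP[-> ->]].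
apply: filterS (ae_mu_all mu_box q (measurable_itv _) m1) => y hy.
by apply/all_tnthP => i; have := hy i; rewrite /= in_itv/= andbT.
Qed.

Lemma sliceE q u : u != 0 -> u != t ->
  slice q u = ((in_half u)%:R%:E * ((u ^+ q * p q (t / u))%:E * h u))%E.
Proof.
move=> u0 ut; rewrite /slice; case: (boolP (in_half u)) => hu; last first.
  rewrite mul0e integral0_eq// => y _.
  by rewrite /mxfun /good_chain/= (negbTE hu)/= mul0e mule0.
rewrite mul1e; have u_gt0 : 0 < u by rewrite lt_neqAle eq_sym u0; case/andP: hu.
have u1 : 0 < u <= 1 by rewrite u_gt0/=; case/andP: hu; lra.
pose b (y : q.-tuple R) := all (fun z => z < u) y &&
  full_chain (t / u) (map_tuple (fun z => z / u) y).
have mb : measurable_fun setT b.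
  apply: measurable_and.
    by apply: measurable_tuple_all; exact: measurable_fun_ltr.
  apply: (measurableT_comp (measurable_full_chain (t / u) (n := q))).
  apply/measurable_fun_tnthP => i.
  rewrite (_ : _ \o _ = fun x => tnth x i / u).
    by apply: measurable_funM => //; exact: measurable_tnth.
  by apply/funext => x /=; rewrite tnth_map.
transitivity (\int[mu q]_y ((b y)%:R%:E * h u))%E.
  apply: ge0_ae_eq_integral => //.
  - apply: emeasurable_funM.
      apply: measurable_boolR.
      have mc : measurable_fun setT (fun y : q.-tuple R => [tuple of u :: y]).
        exact: measurable_cons.
      exact: (measurableT_comp (measurable_top ord0) mc).
    have mc : measurable_fun setT (fun y : q.-tuple R => [tuple of u :: y]).
      exact: measurable_cons.
    exact: (measurableT_comp (@measurable_mxfun q.+1) mc).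
  - by apply: emeasurable_funM => //; exact: measurable_boolR.
  - by move=> y _; rewrite mule_ge0 ?lee_fin ?mxfun_ge0.
  - by move=> y _; rewrite mule_ge0 ?lee_fin.
  (* Being below [u <= 1/2] places the points of [y] in [in_half] only once they are nonnegative,
     which holds almost surely. *)
  apply: filterS (ae_mu_ge0 q) => y y0 _.
  rewrite top_cons /b; case: (boolP (all _ y)) => yu /=; last by rewrite !mul0e.
  rewrite mul1e /mxfun mx_cons_lt// /good_chain/= hu/= (chain_cons_scale _ u_gt0)//.
  rewrite (_ : all in_half y) //; apply/allP => z zy.
  have := allP y0 _ zy; have := allP yu _ zy; case/andP: hu => ? ? /= ? ?.
  by apply/andP; split; lra.
rewrite ge0_integralZr//; last exact: (measurable_boolR mb).
rewrite (integral_boolR _ mb); congr (_ * _)%E.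
rewrite EFinM pE; last first.
  by apply: contra ut => /eqP tu; rewrite -[u]mul1r -tu divfK.
rewrite -[RHS](mu_lt_scale mu_box)//.
  by congr (mu q _); apply/seteqP; split=> y /= /andP.
by have := @measurable_full_chain (t / u) q measurableT [set true]; rewrite setTI; apply.
Qed.

Lemma measurable_slice q : measurable_fun [set: measurableTypeR R] (slice q).
Proof.
pose T1 := measurableTypeR R.
have mc : measurable_fun [set: (T1 * q.-tuple R)%type]
    (fun z => [tuple of (z.1 : R) :: z.2] : q.+1.-tuple R).
  exact: measurable_cons_tuple.
have mg : measurable_fun [set: (T1 * q.-tuple R)%type]
    (fun z => ((is_top [tuple of (z.1 : R) :: z.2] ord0)%:R%:E *
      mxfun [tuple of (z.1 : R) :: z.2])%E).
  apply: emeasurable_funM.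
    by apply: measurable_boolR; exact: (measurableT_comp (measurable_top ord0) mc).
  exact: (measurableT_comp (@measurable_mxfun q.+1) mc).
apply: (@measurable_fun_fubini_tonelli_F _ _ _ _ _ (mu q) _ mg) => z.
by rewrite mule_ge0 ?lee_fin ?mxfun_ge0.
Qed.

(* Almost surely exactly one coordinate is the strict maximum; by exchangeability
   it may be taken to be the first, at the cost of the factor [q.+1]. *)
Lemma integral_mxfun q :
  (\int[mu q.+1]_x mxfun x =
   \int[lambda]_(v in `[0%R, (2^-1)%R])
     ((q.+1%:R * v ^+ q * p q (t / v))%R%:E * h v))%E.
Proof.
transitivity (\int[mu q.+1]_x \sum_(i < q.+1) ((is_top x i)%:R%:E * mxfun x))%E.
  apply: ge0_ae_eq_integral => //.
  - exact: measurable_mxfun.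
  - apply: emeasurable_sum => i; apply: emeasurable_funM.
      by apply: measurable_boolR; exact: measurable_top.
    exact: measurable_mxfun.
  - by move=> x _; exact: mxfun_ge0.
  - by move=> x _; apply: sume_ge0 => i _; rewrite mule_ge0 ?lee_fin ?mxfun_ge0.
  apply: filterS (ae_mu_uniq mu_box q.+1) => x /sum_top x1 _.
  rewrite -ge0_sume_distrl; last by move=> i _; rewrite lee_fin.
  by rewrite sumEFin x1 mul1e.
rewrite ge0_integral_sum//; last 2 first.
- move=> i; apply: emeasurable_funM; last exact: measurable_mxfun.
  by apply: measurable_boolR; exact: measurable_top.
- by move=> i x _; rewrite mule_ge0 ?lee_fin ?mxfun_ge0.
pose F (x : q.+1.-tuple R) := ((is_top x ord0)%:R%:E * mxfun x)%E.
have mF : measurable_fun setT F.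
  apply: emeasurable_funM; last exact: measurable_mxfun.
  by apply: measurable_boolR; exact: measurable_top.
have F0 x : (0 <= F x)%E by rewrite mule_ge0 ?lee_fin ?mxfun_ge0.
have E i : (\int[mu q.+1]_x ((is_top x i)%:R%:E * mxfun x) = \int[unif]_u slice q u)%E.
  rewrite -[RHS](mu_cons mu_box mF F0) -(mu_perm mu_box (tperm ord0 i) mF F0).
  apply: eq_integral => x _; rewrite /F top_perm tpermL; congr (_ * _)%E.
  apply: mxfun_perm; rewrite perm_sym; apply/tuple_permP.
  by exists (tperm ord0 i).
rewrite (eq_bigr (fun=> 1%:E * \int[unif]_u slice q u)%E); last first.
  by move=> i _; rewrite mul1e.
rewrite -ge0_sume_distrl// sumEFin sumr_const card_ord.
pose G (u : measurableTypeR R) :=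
  ((in_half u)%:R%:E * ((u ^+ q * p q (t / u))%:E * h u))%E.
have mG : measurable_fun setT G.
  apply: emeasurable_funM; first by apply: measurable_boolR; exact: measurable_in_half.
  apply: emeasurable_funM => //; apply/measurable_EFinP; apply: measurable_funM.
    exact: measurable_funX.
  exact: measurable_p_div.
have G0 u : (0 <= G u)%E.
  rewrite /G; case: (boolP (in_half u)) => [/andP[u0 _]|_]; last by rewrite mul0e.
  by rewrite !mule_ge0// lee_fin mulr_ge0// exprn_ge0.
have -> : (\int[unif]_u slice q u = \int[unif]_u G u)%E.
  apply: ge0_ae_eq_integral => //.
  - exact: measurable_slice.
  - move=> u _; apply: integral_ge0 => y _.
    by rewrite mule_ge0 ?lee_fin ?mxfun_ge0.
  (* The two values excluded in [sliceE] form a null set. *)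
  exists [set 0; t]; split.
  - by apply: measurableU.
  - apply/eqP; rewrite eq_le measure_ge0 andbT.
    apply: le_trans (measureU2 _ _ _) _ => //.
    by rewrite [X in (X + _)%E]uniform01_set1 [X in (_ + X)%E]uniform01_set1 adde0.
  - move=> u /= hu; apply: contrapT => u0t; apply: hu => _.
    by apply: sliceE; apply/eqP => e; apply: u0t; [left|right].
rewrite integral_uniform// subr0 invr1 mul1e.
rewrite -ge0_integralZl//; last exact: measurable_funTS.
(* After extension by zero, the indicator [in_half] cuts the domain [0, 1] of the uniform law down
   to [0, 1/2]. *)
rewrite [LHS]integral_mkcond [RHS]integral_mkcond.
apply: eq_integral => u _; rewrite /= !patchE /G /in_half !mem_setE !in_itv/=.
case: (boolP (0 <= u <= 2^-1)) => hu.
  rewrite (_ : 0 <= u <= 1); last by case/andP: hu => -> /=; lra.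
  by rewrite mul1e muleA -EFinM mulrA.
by rewrite mul0e mule0; case: ifP.
Qed.

End maximum_law.

(** * Splitting the sample at 1/2 *)

Section splitting.
Context (R : realType).
Local Notation unif := (uniform_prob (@ltr01 R)).
Variable mu : forall n, probability (n.-tuple R) R.
Hypothesis mu_box : forall n (B : 'I_n -> set R), (forall i, measurable (B i)) ->
  mu n (box B) = (\prod_(i < n) unif (B i))%E.

Definition lset n (x : n.-tuple R) : {set 'I_n} := [set i | tnth x i < 2^-1]%SET.

Definition initial n k : {set 'I_n} := [set i : 'I_n | (i < k)%N]%SET.

Lemma card_initial n k : (k <= n)%N -> #|initial n k| = k.
Proof.
move=> kn; rewrite -[RHS]card_ord -(@card_imset _ _ (widen_ord kn)); last first.
  by move=> i j /(congr1 val)/= ij; exact: val_inj.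
apply: eq_card => i; rewrite inE; apply/idP/imsetP.
  by move=> ik; exists (Ordinal ik) => //; exact: val_inj.
by move=> [j _ ->] /=.
Qed.

(** List the elements of [J] and then those of its complement; reading off this list is the
    permutation. *)
Lemma ex_perm_initial n (J : {set 'I_n}) :
  exists s : 'S_n, (s @: initial n #|J| = J)%SET.
Proof.
case: n J => [|n] J.
  by exists 1%g; apply/setP => -[].
pose e := enum J ++ enum (~: J)%SET.
have se : size e = n.+1.
  by rewrite size_cat -!cardE cardsC card_ord.
have ue : uniq e.
  rewrite cat_uniq !enum_uniq andbT/=; apply/hasPn => i.
  by rewrite !mem_enum inE.
pose f (i : 'I_n.+1) := nth ord0 e i.
have fi : injective f.
  move=> i j /eqP; rewrite nth_uniq ?se// => /eqP; exact: val_inj.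
exists (perm fi); apply/eqP; rewrite eqEcard; apply/andP; split.
  apply/fintype.subsetP => _ /imsetP[i ik ->]; rewrite permE /f nth_cat -cardE.
  move: ik; rewrite inE => ik; rewrite ik -mem_enum; apply: mem_nth.
  by rewrite -cardE.
rewrite card_imset ?card_initial//; last exact: perm_inj.
by rewrite -[leqRHS](card_ord n.+1) max_card.
Qed.

Lemma lset_perm n (x : n.-tuple R) (s : 'S_n) (J : {set 'I_n}) :
  (lset [tuple tnth x (s i) | i < n] == J) = (lset x == s @: J)%SET.
Proof.
have -> : lset [tuple tnth x (s i) | i < n] = (s @^-1: lset x)%SET.
  by apply/setP => i; rewrite !inE tnth_mktuple.
apply/eqP/eqP => [<-|->].
  apply/setP => i; apply/idP/imsetP.
    by move=> ix; exists ((s^-1)%g i); rewrite ?permKV// inE permKV.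
  by move=> [j]; rewrite inE => jx ->.
by apply/setP => i; rewrite inE mem_imset//; exact: perm_inj.
Qed.

Lemma lset_cat k m (x : k.-tuple R) (y : m.-tuple R) :
  (lset [tuple of x ++ y] == initial (k + m) k) =
  all (fun z => z < 2^-1) x && all (fun z => 2^-1 <= z) y.
Proof.
apply/eqP/andP => [/setP E|[/all_tnthP hx /all_tnthP hy]].
  split; apply/all_tnthP => i.
    by have := E (lshift m i); rewrite !inE tnth_lshift/= ltn_ord.
  have := E (rshift k i); rewrite !inE tnth_rshift/= ltnNge leq_addr/=.
  by move=> /negbT; rewrite -leNgt.
apply/setP => i; rewrite !inE; case: (split_ordP i) => j ->.
  by rewrite tnth_lshift hx/=.
by rewrite tnth_rshift ltNge hy.
Qed.

Lemma measurable_lset n J : measurable_fun [set: n.-tuple R] (fun x => lset x == J).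
Proof.
rewrite (_ : (fun x => _) = (fun x : n.-tuple R =>
    all (fun i => (tnth x i < 2^-1) == (i \in J)) (enum 'I_n))).
  apply: measurable_fun_all => i.
  have m1 : measurable_fun setT (fun x : n.-tuple R => tnth x i < 2^-1).
    by apply: measurable_fun_ltr => //; exact: measurable_tnth.
  case: (i \in J); first by under eq_fun do rewrite eqb_id.
  by under eq_fun do rewrite eqbF_neg; exact: measurable_neg.
apply/funext => x; apply/eqP/allP => [<- i _|h]; first by rewrite inE.
by apply/setP => i; rewrite inE; apply/eqP/h; rewrite mem_enum.
Qed.

Variable F : seq R -> \bar R.
Hypothesis mF : forall n, measurable_fun [set: n.-tuple R] (fun x => F x).
Hypothesis F0 : forall s, (0 <= F s)%E.
Hypothesis F_perm : forall s s', perm_eq s s' -> F s = F s'.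

Definition split_integral k m : \bar R :=
  (\int[mu m]_y \int[mu k]_x
     ((all (fun z => z < 2^-1)%R x && all (fun z => 2^-1 <= z)%R y)%:R%:E
      * F (x ++ y)))%E.

(** By exchangeability only the size of [J] matters: a permutation moves [J] to the initial segment,
    where the tuple can be cut into two independent blocks. *)
Lemma integral_lset n (J : {set 'I_n}) :
  (\int[mu n]_x ((lset x == J)%:R%:E * F x) = split_integral #|J| (n - #|J|))%E.
Proof.
have [s hs] := ex_perm_initial J.
have kn : (#|J| <= n)%N by rewrite -[leqRHS](card_ord n) max_card.
have mG m K : measurable_fun setT
    (fun x : m.-tuple R => ((lset x == K)%:R%:E * F x)%E).
  by apply: emeasurable_funM; 
    [exact: (measurable_boolR (@measurable_lset _ K))|exact: mF].
have G0 m K (x : m.-tuple R) : (0 <= ((lset x == K)%:R%:E * F x))%E.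
  by rewrite mule_ge0 ?lee_fin.
transitivity (\int[mu n]_x ((lset x == initial n #|J|)%:R%:E * F x))%E.
  rewrite -[RHS](mu_perm mu_box s (mG _ _) (G0 _ _)).
  apply: eq_integral => x _; rewrite lset_perm hs; congr (_ * _)%E.
  by apply: F_perm; rewrite perm_sym; apply/tuple_permP; exists s.
move: {s hs} #|J| kn => k kn.
have [m nE] : exists m, n = (k + m)%N by exists (n - k)%N; rewrite subnKC.
subst n; rewrite addKn /split_integral (mu_cat mu_box (mG _ _) (G0 _ _)).
by apply: eq_integral => y _; apply: eq_integral => x _; rewrite lset_cat.
Qed.

Lemma integral_split n :
  (\int[mu n]_x F x = \sum_(k < n.+1) ('C(n, k)%:R%:E * split_integral k (n - k)))%E.
Proof.
transitivity (\int[mu n]_x \sum_(J : {set 'I_n}) ((lset x == J)%:R%:E * F x))%E.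
  apply: eq_integral => x _; rewrite (bigD1 (lset x))//= eqxx mul1e big1 ?adde0// => J.
  by rewrite eq_sym => /negbTE ->; rewrite mul0e.
rewrite ge0_integral_sum//; last 2 first.
- move=> J; apply: emeasurable_funM; last exact: mF.
  exact: (measurable_boolR (@measurable_lset _ J)).
- by move=> J x _; rewrite mule_ge0 ?lee_fin.
rewrite (eq_bigr _ (fun J _ => integral_lset J)).
have cardJ (J : {set 'I_n}) : (#|J| < n.+1)%N.
  by rewrite ltnS -[leqRHS](card_ord n) max_card.
(* The cardinality as a summation index; [inord] is faithful here since [#|J| <= n]. *)
pose kJ (J : {set 'I_n}) : 'I_n.+1 := inord #|J|.
rewrite [LHS](partition_big kJ xpredT)//=.
apply: eq_bigr => k _.
rewrite (eq_bigr (fun=> 1%:E * split_integral k (n - k))%E); last first.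
  by move=> J /eqP <-; rewrite mul1e /kJ inordK.
rewrite -ge0_sume_distrl// sumEFin sumr_const; congr (_%:R%:E * _)%E.
have -> : 'C(n, k) = 'C(#|'I_n|, k) by rewrite card_ord.
rewrite -card_draws cardsE; apply: eq_card => J.
rewrite !unfold_in /=; apply/eqP/eqP => [<-|Jk]; first by rewrite /kJ inordK.
by rewrite /kJ /= inordK.
Qed.

End splitting.

(** * Law of the travel event for product laws *)

Section travel_law.
Context (R : realType).
Local Notation unif := (uniform_prob (@ltr01 R)).
Local Notation lambda := (@lebesgue_measure R).
Variable mu : forall n, probability (n.-tuple R) R.
Hypothesis mu_box : forall n (B : 'I_n -> set R), (forall i, measurable (B i)) ->
  mu n (box B) = (\prod_(i < n) unif (B i))%E.
Variable p : nat -> R -> R.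
Hypothesis p_nd : forall q, {homo p q : s s' / s <= s'}.
Hypothesis p_ge0 : forall q s, 0 <= p q s.
Hypothesis pE : forall q s, s != 1 ->
  (p q s)%:E = mu q [set x : q.-tuple R | full_chain s x].
Variable t : R.
Hypothesis t_ge0 : 0 <= t.

Definition travelable (s : seq R) := chain t s && chain t (reflected s).

Lemma measurable_refl n : measurable_fun [set: n.-tuple R]
  (fun x => map_tuple (fun z => 1 - z) x).
Proof.
apply/measurable_fun_tnthP => i.
rewrite (_ : _ \o _ = fun x => 1 - tnth x i).
  by apply: measurable_funB => //; exact: measurable_tnth.
by apply/funext => x /=; rewrite tnth_map.
Qed.

Lemma measurable_trav n : measurable_fun [set: n.-tuple R] (fun x => travelable x).
Proof.
apply: measurable_and; first exact: measurable_chain.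
exact: (measurableT_comp (measurable_chain t (n := n)) (@measurable_refl n)).
Qed.

Lemma trav_perm s s' : perm_eq s s' -> travelable s = travelable s'.
Proof.
move=> ss'; rewrite /travelable (chain_perm t ss').
by rewrite (chain_perm t (perm_map (fun z => 1 - z) ss')).
Qed.

(** Off this almost sure event the cut into [z < 1/2] and [1/2 <= z] is not symmetric under
    reflection; on it, both sides become the closed condition [in_half]. *)
Definition ordinary (s : seq R) := all (fun z => (0 <= z) && (z != 2^-1)) s.

Lemma ae_mu_ordinary n : {ae mu n, forall x : n.-tuple R, ordinary x}.
Proof.
have := ae_mu_all mu_box n (measurableC (measurable_set1 2^-1)) (uniform01_setC1 2^-1).
apply: filterS2 (ae_mu_ge0 mu_box n) => x x0 /= x2.
apply/all_tnthP => i; rewrite (all_tnthP x0 i)/=.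
by apply/eqP; exact: x2.
Qed.

Definition cross (u v : R) := 1 - v - u - Num.min u v <= t.

Lemma half_lt s : ordinary s -> all (fun z => z < 2^-1) s = all (@in_half R) s.
Proof.
move=> /allP os; apply: eq_in_all => z /os /andP[z0 z2].
by rewrite /in_half z0/= lt_neqAle z2.
Qed.

Lemma half_refl s : ordinary s ->
  all (fun z => 2^-1 <= z) (reflected s) = all (@in_half R) s.
Proof.
move=> /allP os; rewrite all_map; apply: eq_in_all => z /os /andP[z0 z2] /=.
by rewrite /in_half z0/=; apply/idP/idP; lra.
Qed.

Lemma trav_split s s' : ordinary s -> ordinary s' ->
  s != [::] -> s' != [::] ->
  [&& all (fun z => z < 2^-1) s, all (fun z => 2^-1 <= z) (reflected s') &
     travelable (s ++ reflected s')] =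
  good_chain t s && good_chain t s' && cross (maxpt s) (maxpt s').
Proof.
move=> os os' s0 s'0; rewrite half_lt// half_refl// /good_chain.
case: (boolP (all _ s)) => //= hs; 
  case: (boolP (all _ s')) => hs' /=; last by rewrite andbF.
by rewrite /travelable chain_both// andbA.
Qed.

(** With no point on the right, the mirrored sample has a single nontrivial step, from 0 to
    [1 - maxpt s]. This is the source of the lower limit [1 - t] in the single integral. *)
Lemma trav_left s : ordinary s -> s != [::] ->
  all (fun z => z < 2^-1) s && travelable s = good_chain t s && (1 - t <= maxpt s).
Proof.
move=> os s0; rewrite half_lt// /good_chain /travelable.
case: (boolP (all _ s)) => //= hs; rewrite chain_refl//; congr (_ && _).
by apply/idP/idP; lra.
Qed.

Lemma trav_refl s : travelable (reflected s) = travelable s.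
Proof. by rewrite /travelable reflK andbC. Qed.

(** Density in [u] of the maximum of a block that forms a chain; [q] is the block size minus one,
    which avoids natural subtraction. *)
Definition weight q (u : R) : R := q.+1%:R * u ^+ q * p q (t / u).

Local Notation I := `[0%R, (2^-1)%R]%classic.

Definition inner_integral q (v : R) : \bar R :=
  (\int[lambda]_(u in I) ((weight q u)%:E * (cross u v)%:R%:E))%E.

Definition edge_integral q : \bar R :=
  (\int[lambda]_(u in I) ((weight q u)%:E * (1 - t <= u)%R%:R%:E))%E.

Definition split_event (x y : seq R) : bool :=
  [&& all (fun z => z < 2^-1) x, all (fun z => 2^-1 <= z) y & travelable (x ++ y)].

Lemma measurable_piece k m :
  measurable_fun [set: (k.-tuple R * m.-tuple R)%type] (fun z => split_event z.1 z.2).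
Proof.
apply: measurable_and.
  apply: (@measurableT_comp _ _ _ _ _ _
    (fun x : k.-tuple R => all (fun z => z < 2^-1) x)) => //.
  by apply: measurable_tuple_all; exact: measurable_fun_ltr.
apply: measurable_and.
  apply: (@measurableT_comp _ _ _ _ _ _
    (fun x : m.-tuple R => all (fun z => 2^-1 <= z) x)) => //.
  by apply: measurable_tuple_all; exact: measurable_fun_ler.
have mc := @measurable_cat_tuple R k m.
have := measurableT_comp (@measurable_trav (k + m)) mc.
by apply.
Qed.

Definition trav_indic (s : seq R) : \bar R := (travelable s)%:R%:E.

(** The law is invariant under reflection, so the right block may be replaced by its mirror image
    and both blocks are then described by points near 0. *)
Lemma split_integralE k m :
  split_integral mu trav_indic k m =
  (\int[mu m]_y \int[mu k]_x (split_event x (reflected y))%:R%:E)%E.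
Proof.
have mG : measurable_fun setT (fun y : m.-tuple R =>
    \int[mu k]_x (split_event x y)%:R%:E)%E.
  apply: (@measurable_fun_fubini_tonelli_G _ _ _ _ _ (mu k)
    (fun z : k.-tuple R * m.-tuple R => (split_event z.1 z.2)%:R%:E)) => [|z].
    exact: (measurable_boolR (@measurable_piece k m)).
  by rewrite lee_fin.
rewrite [RHS](@mu_refl _ _ mu_box _
  (fun y => \int[mu k]_x (split_event x y)%:R%:E)%E mG); last first.
  by move=> y; apply: integral_ge0 => x _; rewrite lee_fin.
apply: eq_integral => y _; apply: eq_integral => x _.
by rewrite /trav_indic -EFinM -natrM mulnb /split_event -andbA.
Qed.

Lemma measurable_piece_refl k m :
  measurable_fun [set: (k.-tuple R * m.-tuple R)%type]
    (fun z => split_event z.1 (reflected z.2)).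
Proof.
have mr : measurable_fun [set: (k.-tuple R * m.-tuple R)%type]
    (fun z => (z.1, map_tuple (fun z => 1 - z) z.2)).
  apply: measurable_fun_pair => //.
  exact: (measurableT_comp (@measurable_refl m) measurable_snd).
have := measurableT_comp (@measurable_piece k m) mr.
by apply.
Qed.

Lemma measurable_cross d (X : measurableType d) (f g : X -> R) :
  measurable_fun setT f -> measurable_fun setT g ->
  measurable_fun setT (fun x => cross (f x) (g x)).
Proof.
move=> mf mg; apply: measurable_fun_ler => //.
apply: measurable_funB; first apply: measurable_funB; first exact: measurable_funB.
  by [].
exact: measurable_minr.
Qed.

Lemma weight_ge0 q u : 0 <= u -> 0 <= weight q u.
Proof. by move=> u0; rewrite !mulr_ge0// exprn_ge0. Qed.

(** The law of the maximum read backwards, with a crossing indicator as weight. Written over tuples,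
    the inner integral is visibly nonnegative, and Tonelli gives its measurability in [v]. *)
Lemma innerE q v :
  inner_integral q v = (\int[mu q.+1]_x mxfun t (fun u => (cross u v)%:R%:E) x)%E.
Proof.
rewrite (integral_mxfun mu_box p_nd p_ge0 pE)//; first last.
  by apply: measurable_boolR; apply: measurable_cross.
Qed.

Lemma inner_ge0 q v : (0 <= inner_integral q v)%E.
Proof.
rewrite innerE; apply: integral_ge0 => x _.
by rewrite /mxfun mule_ge0 ?lee_fin.
Qed.

Lemma measurable_inner q : measurable_fun setT (inner_integral q).
Proof.
rewrite (_ : inner_integral q = (fun v =>
   \int[mu q.+1]_x mxfun t (fun u => (cross u v)%:R%:E) x)%E); last first.
  by apply/funext => v; exact: innerE.
apply: (@measurable_fun_fubini_tonelli_G _ _ _ _ _ (mu q.+1)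
  (fun z : q.+1.-tuple R * R => mxfun t (fun u => (cross u z.2)%:R%:E) z.1)).
  apply: emeasurable_funM.
    apply: measurable_boolR.
    by have := measurableT_comp (@measurable_good R t q.+1) measurable_fst; apply.
  apply: measurable_boolR; apply: measurable_cross => //.
  by have := measurableT_comp (@measurable_mx R q.+1) measurable_fst; apply.
by move=> z; rewrite /mxfun mule_ge0 ?lee_fin.
Qed.

(** Two nested uses of the law of the maximum: on the right block with weight [inner_integral k],
    then, for a fixed right block [y], on the left block with weight [cross u (maxpt y)]. On
    ordinary tuples the resulting integrand is exactly [split_event]. *)
Lemma split_integral_mid k m :
  split_integral mu trav_indic k.+1 m.+1 =
  (\int[lambda]_(v in I) ((weight m v)%:E * inner_integral k v))%E.
Proof.
rewrite split_integralE.
rewrite -(integral_mxfun mu_box p_nd p_ge0 pE t (@measurable_inner k) (inner_ge0 k)).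
apply: ge0_ae_eq_integral => //.
- apply: (@measurable_fun_fubini_tonelli_G _ _ _ _ _ (mu k.+1)
    (fun z : k.+1.-tuple R * m.+1.-tuple R =>
      (split_event z.1 (reflected z.2))%:R%:E)) => [|z].
    exact: (measurable_boolR (@measurable_piece_refl k.+1 m.+1)).
  by rewrite lee_fin.
- by apply: measurable_mxfun; exact: measurable_inner.
- by move=> y _; apply: integral_ge0 => x _; rewrite lee_fin.
- by move=> y _; apply: mxfun_ge0 => u; exact: inner_ge0.
apply: filterS (ae_mu_ordinary m.+1) => y oy _.
rewrite /mxfun innerE -ge0_integralZl//; last 2 first.
- apply: measurable_mxfun; apply: measurable_boolR.
  exact: measurable_cross.
- by move=> x _; apply: mxfun_ge0 => u; rewrite lee_fin.
apply: ge0_ae_eq_integral => //.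
- have mp : measurable_fun setT (fun x : k.+1.-tuple R => (x, y)).
    exact: measurable_fun_pair.
  apply: measurable_boolR.
  by have := measurableT_comp (@measurable_piece_refl k.+1 m.+1) mp; apply.
- apply: emeasurable_funM => //.
  apply: measurable_mxfun; apply: measurable_boolR.
  exact: measurable_cross.
- by move=> x _; rewrite mule_ge0 ?lee_fin// mxfun_ge0// => u; rewrite lee_fin.
apply: filterS (ae_mu_ordinary k.+1) => x ox _.
rewrite /split_event trav_split// -?size_eq0 ?size_tuple// /mxfun.
by rewrite -!EFinM -!natrM !mulnb -andbA andbCA.
Qed.

Lemma integral_mu0 (H : seq R -> \bar R) : (\int[mu 0]_y H y = H [::])%E.
Proof.
rewrite (eq_integral (fun=> H [::])); last by move=> y _; rewrite tuple0.
rewrite integral_cst// [X in (_ * X)%E](_ : _ = 1%E) ?mule1//.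
exact: probability_setT.
Qed.

Lemma edgeE q :
  edge_integral q =
  (\int[mu q.+1]_x (all (fun z => z < 2^-1)%R x && travelable x)%:R%:E)%E.
Proof.
rewrite -[LHS](integral_mxfun mu_box p_nd p_ge0 pE); last 2 first.
- by apply: measurable_boolR; apply: measurable_fun_ler.
- by move=> u; rewrite lee_fin.
apply: ge0_ae_eq_integral => //.
- apply: measurable_mxfun; apply: measurable_boolR.
  exact: measurable_fun_ler.
- apply: measurable_boolR; apply: measurable_and; last exact: measurable_trav.
  by apply: measurable_tuple_all; exact: measurable_fun_ltr.
- by move=> y _; apply: mxfun_ge0 => u; rewrite lee_fin.
apply: filterS (ae_mu_ordinary q.+1) => x ox _.
by rewrite trav_left// -?size_eq0 ?size_tuple// /mxfun -EFinM -natrM mulnb.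
Qed.

Lemma split_integral_left q : split_integral mu trav_indic q.+1 0 = edge_integral q.
Proof.
rewrite split_integralE edgeE.
rewrite (integral_mu0 (fun y => \int[mu q.+1]_x (split_event x (reflected y))%:R%:E)%E).
by apply: eq_integral => x _; rewrite /split_event/= cats0.
Qed.

(** Travelability is invariant under reflection, so an entirely right-hand sample contributes as
    much as a left-hand one; hence the factor 2 in front of the single integral. *)
Lemma split_integral_right q : split_integral mu trav_indic 0 q.+1 = edge_integral q.
Proof.
rewrite split_integralE edgeE; apply: ge0_ae_eq_integral => //.
- apply: (@measurable_fun_fubini_tonelli_G _ _ _ _ _ (mu 0)
    (fun z : 0.-tuple R * q.+1.-tuple R =>
      (split_event z.1 (reflected z.2))%:R%:E)) => [|z].
    exact: (measurable_boolR (@measurable_piece_refl 0 q.+1)).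
  by rewrite lee_fin.
- apply: measurable_boolR; apply: measurable_and; last exact: measurable_trav.
  by apply: measurable_tuple_all; exact: measurable_fun_ltr.
- by move=> y _; apply: integral_ge0 => x _; rewrite lee_fin.
apply: filterS (ae_mu_ordinary q.+1) => y oy _.
rewrite (integral_mu0 (fun x => (split_event x (reflected y))%:R%:E)).
by rewrite /split_event/= trav_refl half_refl// half_lt.
Qed.

Lemma integral_trav q :
  (\int[mu q.+1]_x trav_indic x =
   \sum_(i < q) ('C(q.+1, i.+1)%:R%:E *
     \int[lambda]_(v in I) ((weight (q - i.+1) v)%:E * inner_integral i v)) +
   2%:E * edge_integral q)%E.
Proof.
rewrite (integral_split mu_box); last 3 first.
- by move=> n; apply: measurable_boolR; exact: measurable_trav.
- by move=> s; rewrite lee_fin.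
- by move=> s s' /trav_perm; rewrite /trav_indic => ->.
(* The extreme terms, with no left point or no right point, have binomial coefficient 1 and give the
   edge integrals; the middle terms have [k = i + 1]. *)
rewrite big_ord_recl big_ord_recr/= bin0 mul1e subn0 split_integral_right.
rewrite /bump/= add1n binn mul1e subnn split_integral_left addeCA.
congr (_ + _)%E; last first.
  rewrite -[X in (X + _)%E]mul1e -[X in (_ + X)%E]mul1e -ge0_muleDl//.
apply: eq_bigr => i _; rewrite /bump/= add1n subSS.
have -> : (q - i = (q - i.+1).+1)%N by rewrite subnS prednK// subn_gt0.
by rewrite split_integral_mid.
Qed.

End travel_law.

(** * The law of the sample and the functions [P_m] *)

Section sample_law.
Context (d : measure_display) (T : measurableType d) (R : realType).
Variables (P : probability T R) (U : forall m : nat, 'I_m -> {RV P >-> R}).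
Hypothesis U_indep : forall m : nat, (1 <= m)%N -> mutually_independent (U (m := m)).
Hypothesis U_unif : forall m : nat, (1 <= m)%N ->
  forall i : 'I_m, uniform01 (U i).
Local Notation unif := (uniform_prob (@ltr01 R)).

Definition sample_tuple m (w : T) : m.-tuple R := [tuple U i w | i < m].

Lemma measurable_sample m : measurable_fun setT (@sample_tuple m).
Proof.
apply/measurable_fun_tnthP => i.
rewrite (_ : _ \o _ = U i); first exact: measurable_funPT.
by apply/funext => w /=; rewrite tnth_mktuple.
Qed.

HB.instance Definition _ m := isMeasurableFun.Build _ _ _ _ (@sample_tuple m)
  (@measurable_sample m).

Definition law m : probability (m.-tuple R) R :=
  distribution P (@sample_tuple m : {mfun T >-> m.-tuple R}).

Lemma lawE m (A : set (m.-tuple R)) : law m A = P [set w | A (sample_tuple m w)].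
Proof. by []. Qed.

Lemma law_box m (B : 'I_m -> set R) : (forall i, measurable (B i)) ->
  law m (box B) = (\prod_(i < m) unif (B i))%E.
Proof.
(* Independence is assumed for [m >= 1]; for [m = 0] the box is the whole space and the product is
   empty. *)
move=> mB; rewrite lawE; case: m B mB => [|m] B mB.
  rewrite big_ord0 (_ : [set _ | _] = setT) ?probability_setT//.
  by apply/seteqP; split=> // w _ [].
have := U_indep (ltn0Sn m) [set: 'I_m.+1]%SET mB.
rewrite (_ : [set w | _] = [set w | box B (sample_tuple m.+1 w)]); last first.
  apply/seteqP; split=> w /= h i; first by rewrite tnth_mktuple; by apply: h; rewrite inE.
  by move=> _; have := h i; rewrite tnth_mktuple.
move=> ->; apply: eq_big => [i|i _]; first by rewrite inE.
exact: (U_unif (ltn0Sn m) i (mB i)).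
Qed.

Lemma Pm_full_chain m s : (0 < m)%N ->
  Pm U m s = fine (law m [set x : m.-tuple R | full_chain s x]).
Proof.
case: m => // m _; rewrite /Pm/= lawE; congr (fine (P _)).
by apply/seteqP; split=> w /=; rewrite max_spacing_le.
Qed.

Lemma Pm_ge0 m s : 0 <= Pm U m s.
Proof. by case: m => [|m]; rewrite ?ler0n// Pm_full_chain// fine_ge0. Qed.

Lemma full_chain_le (s s' : R) x : s <= s' -> full_chain s x -> full_chain s' x.
Proof. by move=> ss'; apply: sub_path => u v; exact: step_le. Qed.

Lemma measurable_set_full_chain m s :
  measurable [set x : m.-tuple R | full_chain s x].
Proof.
by have := @measurable_full_chain R s m measurableT [set true]; rewrite setTI; apply.
Qed.

Lemma Pm_nd m : {homo Pm U m : s s' / s <= s'}.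
Proof.
move=> s s' ss'; case: m => [|m].
  rewrite /Pm/= ler_nat; case: (ltP 1 s) => // s1.
  by rewrite (lt_le_trans s1 ss').
rewrite !Pm_full_chain//; apply: fine_le; rewrite ?fin_num_measure//;
  try exact: measurable_set_full_chain.
apply: le_measure; rewrite ?inE; try exact: measurable_set_full_chain.
by move=> x; exact: full_chain_le.
Qed.

(* For [m = 0] the event is [1 <= s], whereas [P_0 (s) = 1_{s > 1}]: they differ
   at [s = 1]. *)
Lemma PmE m s : s != 1 ->
  (Pm U m s)%:E = law m [set x : m.-tuple R | full_chain s x].
Proof.
move=> s1; case: m => [|m]; last first.
  by rewrite Pm_full_chain// fineK// fin_num_measure//; exact: measurable_set_full_chain.
rewrite -(integral_boolR _ (measurable_full_chain s (n := 0))).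
rewrite (integral_mu0 law (fun x => (full_chain s x)%:R%:E)).
by rewrite /Pm/= /full_chain/= /step mulr0 add0r andbT lt_neqAle eq_sym s1.
Qed.

End sample_law.

Lemma edge_itv (R : realType) (p : nat -> R -> R) (t : R) q : 0 <= t <= 1 ->
  edge_integral p t q = ((2^-1 < t)%R%:R%:E *
    \int[lebesgue_measure]_(u in `[(1 - t)%R, (2^-1)%R]) (weight p t q u)%:E)%E.
Proof.
move=> t01; transitivity
    (\int[lebesgue_measure]_(u in `[(1 - t)%R, (2^-1)%R]) (weight p t q u)%:E)%E.
  rewrite /edge_integral [LHS]integral_mkcond [RHS]integral_mkcond.
  apply: eq_integral => u _; rewrite /= !patchE !mem_setE !in_itv/=.
  case: (boolP (1 - t <= u)) => tu /=.
    by rewrite (_ : 0 <= u) ?mule1//; lra.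
  by rewrite mule0; case: ifP.
case: (ltP 2^-1 t) => t2; first by rewrite mul1e.
(* For [t <= 1/2] the interval is empty or reduced to the point 1/2, so the integral vanishes along
   with the indicator. *)
rewrite mul0e; apply: (@integral_Sset1 _ _ _ 2^-1) => u /=.
by rewrite in_itv/=; lra.
Qed.

(** * Exchanging the finite sum with the double integral *)

Section assembly.
Context (R : realType) (mu : forall n, probability (n.-tuple R) R).
Hypothesis mu_box : forall n (B : 'I_n -> set R), (forall i, measurable (B i)) ->
  mu n (box B) = (\prod_(i < n) uniform_prob (@ltr01 R) (B i))%E.
Variable p : nat -> R -> R.
Hypothesis p_nd : forall q, {homo p q : s s' / s <= s'}.
Hypothesis p_ge0 : forall q s, 0 <= p q s.
Hypothesis pE : forall q s, s != 1 ->
  (p q s)%:E = mu q [set x : q.-tuple R | full_chain s x].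
Variable t : R.
Local Notation lambda := (@lebesgue_measure R).
Local Notation I := `[0%R, (2^-1)%R]%classic.

Lemma measurable_weight q : measurable_fun setT (weight p t q).
Proof.
apply: measurable_funM; last exact: measurable_p_div.
by apply: measurable_funM => //; exact: measurable_funX.
Qed.

(** Nonnegativity on [0, 1/2] lets the sum leave both integrals. The summand [E] stays abstract and
    is constrained only for [1 <= k <= q], where no natural subtraction is truncated. *)
Lemma double_integral_sum q (E : nat -> R -> R -> R) :
  (forall i u v, (i < q)%N ->
    E i.+1 v u = 'C(q.+1, i.+1)%:R * weight p t i u * weight p t (q - i.+1) v *
             (cross t u v)%:R) ->
  (\int[lambda]_(v in I) \int[lambda]_(u in I) (\sum_(1 <= k < q.+1) E k v u)%R%:E =
   \sum_(i < q) ('C(q.+1, i.+1)%:R%:E *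
     \int[lambda]_(v in I) ((weight p t (q - i.+1) v)%:E * inner_integral p t i v)))%E.
Proof.
move=> hE.
have I0 (u : R) : I u -> 0 <= u by rewrite /= in_itv/= => /andP[].
have mw k : measurable_fun (I : set (measurableTypeR R)) (EFin \o weight p t k).
  by apply/measurable_EFinP; apply: measurable_funTS; exact: measurable_weight.
have mi k : measurable_fun (I : set (measurableTypeR R)) (inner_integral p t k).
  apply: measurable_funTS.
  exact: (measurable_inner mu_box p_nd p_ge0 pE).
have i0 k v : (0 <= inner_integral p t k v)%E by exact: (inner_ge0 mu_box p_nd p_ge0 pE).
have w0 k u : I u -> (0 <= (weight p t k u)%:E)%E.
  by move=> /I0 u0; rewrite lee_fin weight_ge0.
transitivity (\int[lambda]_(v in I) \sum_(i < q) ('C(q.+1, i.+1)%:R%:E *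
    ((weight p t (q - i.+1) v)%:E * inner_integral p t i v)))%E.
  apply: eq_integral => v; rewrite inE => Iv.
  have cw0 k : (0 <= ('C(q.+1, k.+1)%:R * weight p t (q - k.+1) v)%:E :> \bar R)%E.
    by rewrite EFinM mule_ge0 ?w0// lee_fin.
  have mc k : measurable_fun (I : set (measurableTypeR R))
      (fun u => (weight p t k u)%:E * (cross t u v)%:R%:E)%E.
    apply: emeasurable_funM; first exact: mw.
    apply: measurable_funTS; apply: measurable_boolR.
    exact: measurable_cross.
  have c0 k u : I u -> (0 <= (weight p t k u)%:E * (cross t u v)%:R%:E)%E.
    by move=> Iu; rewrite mule_ge0 ?w0// lee_fin.
  transitivity (\int[lambda]_(u in I) \sum_(i < q)
      (('C(q.+1, i.+1)%:R * weight p t (q - i.+1) v)%:E *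
       ((weight p t i u)%:E * (cross t u v)%:R%:E)))%E.
    apply: eq_integral => u _; rewrite big_add1/= big_mkord -sumEFin.
    apply: eq_bigr => i _; rewrite hE// -!EFinM; congr EFin; ring.
  rewrite ge0_integral_sum//; last 2 first.
  - by move=> i; apply: emeasurable_funM => //; exact: mc.
  - by move=> i u Iu; rewrite mule_ge0 ?c0.
  apply: eq_bigr => i _; rewrite ge0_integralZl//; last exact: c0.
  by rewrite EFinM muleA.
rewrite ge0_integral_sum//; last 2 first.
- by move=> i; apply: emeasurable_funM => //; apply: emeasurable_funM;
    [exact: mw|exact: mi].
- by move=> i v Iv; rewrite !mule_ge0 ?w0// lee_fin.
apply: eq_bigr => i _; rewrite ge0_integralZl//.
- by apply: emeasurable_funM; [exact: mw|exact: mi].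
- by move=> v Iv; rewrite mule_ge0 ?w0.
Qed.

End assembly.

Theorem mainTheorem2 (d : measure_display) (T : measurableType d)
    (R : realType) (P : probability T R)
    (U : forall m : nat, 'I_m -> {RV P >-> R})
    (U_indep : forall m : nat, (1 <= m)%N -> mutually_independent (U m))
    (U_unif : forall m : nat, (1 <= m)%N -> forall i : 'I_m, uniform01 (U m i))
    (n : nat) (n_ge1 : (1 <= n)%N) (t : R) (t_ge0 : 0 <= t) (t_le1 : t <= 1) :
  P [set w | travel_time (fun i => U n i w) >= 1 - t] =
  (\int[lebesgue_measure]_(v in `[0%R, (2^-1)%R])
     \int[lebesgue_measure]_(u in `[0%R, (2^-1)%R])
       (\sum_(1 <= k < n)
          'C(n, k)%:R * k%:R * u ^+ (k - 1)
          * (n - k)%:R * v ^+ (n - k - 1)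
          * Pm U (k - 1) (t / u) * Pm U (n - k - 1) (t / v)
          * (1 - v - u - Num.min u v <= t)%R%:R)%R%:E
   + (2 * (2^-1 < t)%R%:R)%R%:E *
     \int[lebesgue_measure]_(u in `[(1 - t)%R, (2^-1)%R])
       (n%:R * u ^+ (n - 1) * Pm U (n - 1) (t / u))%R%:E)%E.
Proof.
pose mu := law U.
have mu_box := law_box U_indep U_unif.
have p_nd := @Pm_nd _ _ _ P U.
have p_ge0 := @Pm_ge0 _ _ _ P U.
have pE := @PmE _ _ _ P U.
case: n n_ge1 => // q _.
transitivity (\int[mu q.+1]_x trav_indic t x)%E.
  rewrite (integral_boolR _ (@measurable_trav R t q.+1)) [RHS]lawE.
  by congr (P _); apply/seteqP; split=> w /=; rewrite travel_time_ge.
rewrite (integral_trav mu_box p_nd p_ge0 pE t_ge0); congr (_ + _)%E.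
  pose E k v u : R := 'C(q.+1, k)%:R * k%:R * u ^+ (k - 1)
    * (q.+1 - k)%:R * v ^+ (q.+1 - k - 1)
    * Pm U (k - 1) (t / u) * Pm U (q.+1 - k - 1) (t / v)
    * (1 - v - u - Num.min u v <= t)%R%:R.
  apply/esym/(double_integral_sum mu_box p_nd p_ge0 pE (E := E)) => i u v iq.
  rewrite /E /weight /cross !subn1/= subSS -subnS.
  (* With [n = q + 1] and [k = i + 1], the factor [n - k] is the leading coefficient of [weight] at
     index [q - i.+1]. *)
  have -> : (q - i)%:R = (q - i.+1).+1%:R :> R by rewrite subnSK.
  by ring.
by rewrite edge_itv ?t_ge0// muleA -EFinM /weight subn1.
Qed.
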